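(* Let $\{T_t\}_{t\ge0}$ be a Feller semigroup on $\mathbb{R}^d$ with generator $(A,D(A))$ such that $C_c^\infty(\mathbb{R}^d)\subset D(A)$, with symbol $p(x,\xi)$ and transition function $P_t(x,dy)$. Suppose that there is a constant $c>0$ with $\sup_{x\in\mathbb{R}^d}|p(x,\xi)|\le c(1+|\xi|^2)$ for every $\xi\in\mathbb{R}^d$ and that the function $x\mapsto p(x,0)$ is continuous. The semigroup $\{T_t\}_{t\ge0}$ has the strong Feller property if one of the following conditions is satisfied: (1) For every $t>0$, the family of measures $(P_t(x,dy))_{x\in\mathbb{R}^d}$ is locally uniformly absolutely continuous with respect to Lebesgue measure, i.e. for any compact set $K\subset\mathbb{R}^d$ $$\lim_{\varepsilon\to0}\ \sup_{B\in\mathcal{B}(\mathbb{R}^d),\,\mathrm{Leb}(B)\le\varepsilon}\ \sup_{z\in K}P_t(z,B)=0.$$ (2) For every $t>0$ there exists some Young function $\Phi_t:\mathbb{R}\to[0,\infty)$ such that $\Phi_t(x)=0$ if and only if $x=0$ and such that for every compact set $K\subset\mathbb{R}^d$ there is a constant $C(K,t)<\infty$ with $$\sup_{x\in K}|T_tu(x)|\le C(K,t)\|u\|_{\Phi_t}\quad\text{for all }u\in C_c^\infty(\mathbb{R}^d),$$ where $\|\cdot\|_{\Phi_t}$ denotes the norm of the Orlicz space $\mathbb{L}^{\Phi_t}(\mathrm{Leb})$.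
   Context: $B_b$, $C_b$, $C_\infty$ denote the bounded Borel functions, the bounded continuous functions, and the continuous functions vanishing at infinity on $\mathbb{R}^d$. A Feller semigroup is a sub-Markovian semigroup $T_tu(x)=\int u(y)P_t(x,dy)$ ($P_t(x,dy)$ sub-probability kernels; $0\le u\le1$ implies $0\le T_tu\le1$) on $B_b(\mathbb{R}^d)$ such that $T_t$ maps $C_\infty(\mathbb{R}^d)$ into itself and $\lim_{t\to0}\|T_tf-f\|_\infty=0$ for all $f\in C_\infty(\mathbb{R}^d)$. Its generator is $Au=\lim_{t\to0}(T_tu-u)/t$ (limit in sup-norm) on the set $D(A)\subset C_\infty(\mathbb{R}^d)$ where the limit exists. Strong Feller property: $T_tf\in C_b(\mathbb{R}^d)$ for all $f\in B_b(\mathbb{R}^d)$ and all $t>0$. If $C_c^\infty(\mathbb{R}^d)\subset D(A)$, then on $C_c^\infty(\mathbb{R}^d)$ the generator is a pseudo-differential operator $Au(x)=-p(x,D)u(x)=-\int_{\mathbb{R}^d}e^{ix\cdot\xi}p(x,\xi)\hat u(\xi)\,d\xi$, $\hat u(\xi)=(2\pi)^{-d}\int e^{-ix\cdot\xi}u(x)\,dx$, with locally bounded symbol $p:\mathbb{R}^d\times\mathbb{R}^d\to\mathbb{C}$ of Lévy–Khinchine form $$p(x,\xi)=\tfrac12\,\xi\cdot a(x)\xi-ib(x)\cdot\xi+\int_{z\ne0}\big(1-e^{iz\cdot\xi}+iz\cdot\xi\,\mathbf{1}_{\{|z|\le1\}}\big)\,\nu(x,dz),$$ where for each $x$, $a(x)$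 is a nonnegative definite matrix, $b(x)\in\mathbb{R}^d$, and $\nu(x,dz)$ is a measure on $\mathbb{R}^d\setminus\{0\}$ with $\int(1\wedge|z|^2)\,\nu(x,dz)<\infty$. A Young function is a convex, even function $\Phi$ with $\Phi(0)=0$ and $\lim_{x\to\infty}\Phi(x)=\infty$. For a Radon measure $\mu$, $\mathbb{L}^\Phi(\mu)=\{f\text{ measurable}:\int\Phi(\alpha f)\,d\mu<\infty\text{ for some }\alpha>0\}$ with Orlicz norm $\|f\|_\Phi=\sup\{\int|fg|\,d\mu:\int\Phi_c(g)\,d\mu\le1\}$, where $\Phi_c(y)=\sup_{x\ge0}(x|y|-\Phi(x))$. *)

(* Defs.v *)
From HB Require Import structures.
From mathcomp Require Import all_boot all_order all_algebra.
From mathcomp Require Import complex.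
From mathcomp Require Import all_classical all_reals all_analysis.
From mathcomp Require Import measurable_realfun.

Set Implicit Arguments.
Unset Strict Implicit.
Unset Printing Implicit Defensive.

Import Order.TTheory GRing.Theory Num.Theory.
Import numFieldNormedType.Exports.

Local Open Scope classical_set_scope.
Local Open Scope ring_scope.

(* R^d is the type of row vectors 'rV[R]_d. Its library norm `|x| is the
   maximum norm, which induces the usual topology; the Euclidean norm is enorm. *)

HB.instance Definition _ (R : realType) (d : nat) :=
  Measurable.copy 'rV[R]_d (g_sigma_algebraType (@open 'rV[R]_d)).

Section borel_rV.
Context {R : realType}.

Lemma open_measurable_rV d (U : set 'rV[R]_d) : open U -> measurable U.
Proof. by move=> oU; apply: sub_gen_smallest. Qed.

Lemma measurable_coord d (i : 'I_d) :
  measurable_fun [set: 'rV[R]_d] (fun x => x ord0 i).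
Proof.
apply: (measurability _ (RGenOpens.measurableE R)).
move=> _ [_ [a [b ->]] <-]; rewrite setTI; apply: open_measurable_rV.
apply: open_comp; last exact: interval_open.
by move=> x _; exact: coord_continuous.
Qed.

Lemma measurable_fun_rV disp (T : measurableType disp) d (f : T -> 'rV[R]_d) :
  (forall i, measurable_fun [set: T] (fun t => f t ord0 i)) ->
  measurable_fun [set: T] f.
Proof.
move=> mf; apply: (@measurability _ _ _ _ _ _ (@open 'rV[R]_d)) => //.
move=> _ [U oU <-]; rewrite setTI.
pose K := ('rV[rat]_d * nat)%type.
pose B (k : K) := [set y : 'rV[R]_d |
  forall j, ball (ratr (k.1 ord0 j) : R) k.2.+1%:R^-1 (y ord0 j)].
have -> : f @^-1` U = \bigcup_(k in [set k | B k `<=` U]) f @^-1` (B k).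
  apply/seteqP; split => [t /= Uft|t [k /= BU]]; last exact: BU.
  have /nbhs_ballP[e /= e0 eU] : nbhs (f t) U by exact: open_nbhs_nbhs.
  have [n n2e] : exists n : nat, n.+1%:R^-1 < e / 2.
    have e20 : 0 < e / 2 by rewrite divr_gt0.
    exists (Num.bound (e / 2)^-1).
    rewrite -[ltRHS]invrK ltf_pV2 ?posrE ?invr_gt0//.
    by rewrite (lt_trans (archi_boundP _)) ?ltr_nat// ltW// invr_gt0.
  have qj (j : 'I_d) : exists q : rat, `|ratr q - f t ord0 j| < n.+1%:R^-1.
    have /rat_in_itvoo[q] : f t ord0 j - n.+1%:R^-1 < f t ord0 j + n.+1%:R^-1.
      by rewrite ltrBlDr -addrA ltrDl addr_gt0.
    rewrite in_itv /= => /andP[q1 q2]; exists q.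
    by rewrite ltr_distl q1 q2.
  have [q qE] := choice qj.
  exists (\row_j q j, n) => /=; last first.
    by move=> j; rewrite mxE /ball/=; exact: qE.
  move=> y /= By; apply: eU; split => // i j; rewrite (ord1 i).
  have := By j; rewrite mxE /= /ball /= => yj.
  rewrite (le_lt_trans (ler_distD (ratr (q j)) _ _))// [ltRHS]splitr.
  rewrite ltrD//; last exact: lt_trans yj n2e.
  by rewrite distrC (lt_trans (qE j)).
rewrite bigcup_mkcond; apply: countable_bigcupT_measurable => [|k].
  exact: countableP.
case: ifPn => // _.
have -> : f @^-1` B k = \bigcap_(j in [set: 'I_d])
    ((fun t => f t ord0 j) @^-1` ball (ratr (k.1 ord0 j) : R) k.2.+1%:R^-1).
  by apply/seteqP; split => t /= h j; [move=> _; exact: h|exact: (h j I)].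
apply: fin_bigcap_measurable => // j _.
by rewrite -[X in measurable X]setTI; apply: mf => //; exact: measurable_ball.
Qed.

Definition rcons_rV d (vx : 'rV[R]_d * R) : 'rV[R]_d.+1 :=
  \row_(i < d.+1) if unlift ord_max i is Some j then vx.1 ord0 j else vx.2.

Lemma measurable_rcons_rV d : measurable_fun setT (@rcons_rV d).
Proof.
apply: measurable_fun_rV => i; rewrite /rcons_rV.
case: (unliftP ord_max i) => [j ij|ij].
  rewrite (_ : (fun t => _) = (fun x : 'rV[R]_d => x ord0 j) \o fst); last first.
    by apply/funext => t /=; rewrite mxE ij liftK.
  by apply: measurableT_comp => //; exact: measurable_coord.
rewrite (_ : (fun t => _) = snd) //.
by apply/funext => t; rewrite mxE ij unlift_none.
Qed.


Section lebesgue_step.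
Variables (d : nat) (m : {measure set 'rV[R]_d -> \bar R}).

Definition lebesgue_step : set 'rV[R]_d.+1 -> \bar R :=
  pushforward (m \x lebesgue_measure)%E (@rcons_rV d).

Let step0 : lebesgue_step set0 = 0%E.
Proof. by apply: measure0; exact: measurable_rcons_rV. Qed.

Let step_ge0 A : (0 <= lebesgue_step A)%E.
Proof. by apply: measure_ge0; exact: measurable_rcons_rV. Qed.

Let step_sigma_additive : semi_sigma_additive lebesgue_step.
Proof.
by apply: measure_semi_sigma_additive; exact: measurable_rcons_rV.
Qed.

HB.instance Definition _ := isMeasure.Build _ _ _ lebesgue_step
  step0 step_ge0 step_sigma_additive.

End lebesgue_step.

(* Lebesgue measure on R^d as an iterated product measure; lebesgue_rV_box
   checks its value on half-open boxes, which determines it. *)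
Fixpoint lebesgue_rV (d : nat) : {measure set 'rV[R]_d -> \bar R} :=
  match d with
  | 0 => \d_(0 : 'rV[R]_0)
  | d'.+1 => lebesgue_step (lebesgue_rV d')
  end.

Lemma lebesgue_rV_box d (a b : 'rV[R]_d) : (forall i, a ord0 i <= b ord0 i) ->
  lebesgue_rV d [set x | forall i, a ord0 i < x ord0 i <= b ord0 i] =
  (\prod_i (b ord0 i - a ord0 i))%:E.
Proof.
elim: d a b => [|d IH] a b ab.
  by rewrite big_ord0 /= diracE mem_set// => -[].
pose w := widen_ord (leqnSn d).
have wE i : w i = lift ord_max i :> 'I_d.+1.
  by apply: val_inj; rewrite /= /bump leqNgt ltn_ord.
pose a' : 'rV[R]_d := \row_i a ord0 (w i).
pose b' : 'rV[R]_d := \row_i b ord0 (w i).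
pose B := [set x : 'rV[R]_d | forall i, a' ord0 i < x ord0 i <= b' ord0 i].
transitivity ((lebesgue_rV d \x lebesgue_measure)%E
    (B `*` `]a ord0 ord_max, b ord0 ord_max])).
  congr (product_measure1 _ _ _).
  apply/seteqP; split => [[v x] /= h|[v x] /= [h1 h2] i].
    split; last by have := h ord_max; rewrite mxE unlift_none/= in_itv.
    by move=> i; have := h (w i); rewrite wE !mxE liftK/= wE.
  rewrite mxE; case: unliftP => [j ->|->] /=; last by move: h2; rewrite in_itv.
  by have := h1 j; rewrite !mxE wE.
have mB : measurable B.
  rewrite (_ : B = \bigcap_(i in [set: 'I_d])
      ((fun x : 'rV[R]_d => x ord0 i) @^-1` `]a' ord0 i, b' ord0 i])); last first.
    apply/seteqP; split => x /= h i; first by move=> _ /=; rewrite in_itv/= h.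
    by have := h i I; rewrite /= in_itv.
  apply: fin_bigcap_measurable => // i _.
  by rewrite -[X in measurable X]setTI; exact: measurable_coord.
rewrite product_measure1E//= IH; last by move=> i; rewrite !mxE.
rewrite lebesgue_measure_itv/= lte_fin big_ord_recr/= EFinM.
congr (_ * _)%E.
  by congr (_%:E); apply: eq_bigr => i _; rewrite !mxE.
have := ab ord_max; rewrite le_eqVlt => /predU1P[->|->//].
by rewrite ltxx subrr.
Qed.
End borel_rV.

Section euclidean.
Context {R : realType} {d : nat}.
Implicit Types x y : 'rV[R]_d.

Definition dot x y : R := \sum_(i < d) x ord0 i * y ord0 i.

Definition enorm x : R := Num.sqrt (dot x x).

End euclidean.

Section function_spaces.
Context {R : realType} {d : nat}.
Implicit Types u : 'rV[R]_d -> R.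

Definition sup_norm u : \bar R := ereal_sup [set `|u x|%:E | x in setT].

Definition borel_bounded u : Prop := measurable_fun setT u /\ bounded_fun u.

Definition continuous_bounded u : Prop := continuous u /\ bounded_fun u.

Definition continuous_vanishing u : Prop :=
  continuous u /\
  forall e : R, 0 < e -> exists r : R, forall x, r < enorm x -> `|u x| < e.

(* partials [:: i1; ..; ik] u = d_{i1} .. d_{ik} u *)
Definition partials (s : seq 'I_d) u : 'rV[R]_d -> R :=
  foldr (fun i v => 'D_(delta_mx ord0 i) v) u s.

Definition smooth u : Prop := forall s : seq 'I_d,
  continuous (partials s u) /\
  forall (i : 'I_d) (x : 'rV[R]_d), derivable (partials s u) x (delta_mx ord0 i).

Definition test_function u : Prop :=
  smooth u /\ compact (closure [set x | u x != 0]).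

End function_spaces.

Section semigroup.
Context {R : realType} {d : nat}.
Implicit Types (P : R -> R.-spker 'rV[R]_d ~> 'rV[R]_d) (u g : 'rV[R]_d -> R).

(* Time ranges over R, but only the kernels P t with t >= 0 are used. *)
Definition semigroup_op P (t : R) u : 'rV[R]_d -> R := fun x => \int[P t x]_y u y.

Record feller_semigroup P : Prop := FellerSemigroup {
  feller_0 : forall u, borel_bounded u -> semigroup_op P 0 u = u ;
  feller_add : forall (s t : R) u, 0 <= s -> 0 <= t -> borel_bounded u ->
    semigroup_op P (s + t) u = semigroup_op P s (semigroup_op P t u) ;
  feller_vanishing : forall (t : R) u, 0 <= t ->
    continuous_vanishing u -> continuous_vanishing (semigroup_op P t u) ;
  feller_cont : forall u, continuous_vanishing u ->
    sup_norm (semigroup_op P t u \- u) @[t --> 0^'+] --> 0%E }.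

(* The graph of the generator: u is in D(A) and A u = g. *)
Definition generator P u g : Prop :=
  continuous_vanishing u /\
  sup_norm (fun x => t^-1 * (semigroup_op P t u x - u x) - g x) @[t --> 0^'+] --> 0%E.

Definition generator_dom P : set ('rV[R]_d -> R) :=
  [set u | exists g, generator P u g].

Definition strong_feller P : Prop := forall (t : R) u,
  0 < t -> borel_bounded u -> continuous_bounded (semigroup_op P t u).

End semigroup.

Section symbol.
Local Open Scope complex_scope.
Context {R : realType}.

Definition cabs (z : R[i]) : R := ComplexField.Normc.normc z.

Definition expi (r : R) : R[i] := cos r +i* sin r.

Definition cintegral disp (T : measurableType disp)
    (mu : {measure set T -> \bar R}) (D : set T) (f : T -> R[i]) : R[i] :=
  (\int[mu]_(x in D) complex.Re (f x)) +i* (\int[mu]_(x in D) complex.Im (f x)).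

Context {d : nat}.

Definition fourier (u : 'rV[R]_d -> R) (xi : 'rV[R]_d) : R[i] :=
  ((2 * pi) ^- d)%:C *
  cintegral (@lebesgue_rV R d) setT (fun x => expi (- dot x xi) * (u x)%:C).

(* p(x,D) u (x) *)
Definition pdo (p : 'rV[R]_d -> 'rV[R]_d -> R[i]) (u : 'rV[R]_d -> R)
    (x : 'rV[R]_d) : R[i] :=
  cintegral (@lebesgue_rV R d) setT
    (fun xi => expi (dot x xi) * p x xi * fourier u xi).

Definition nonneg_definite (a : 'M[R]_d) : Prop :=
  a^T = a /\ forall xi : 'rV[R]_d, 0 <= dot xi (xi *m a).

(* A measure on R^d \ {0}, encoded as a measure on R^d that does not charge 0. *)
Definition levy_measure (nu : {measure set 'rV[R]_d -> \bar R}) : Prop :=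
  nu [set 0] = 0%E /\
  (\int[nu]_(z in [set~ (0%R : 'rV[R]_d)]) (Num.min 1 (enorm z ^+ 2))%:E < +oo)%E.

Definition levy_khinchine (a : 'M[R]_d) (b : 'rV[R]_d)
    (nu : {measure set 'rV[R]_d -> \bar R}) (xi : 'rV[R]_d) : R[i] :=
  (2^-1 * dot xi (xi *m a))%:C - (0 +i* dot b xi) +
  cintegral nu [set~ (0%R : 'rV[R]_d)] (fun z =>
    1 - expi (dot z xi) + (0 +i* (dot z xi * (enorm z <= 1)%R%:R))).

Definition locally_bounded (p : 'rV[R]_d -> 'rV[R]_d -> R[i]) : Prop :=
  forall K : set ('rV[R]_d * 'rV[R]_d), compact K ->
  exists M : R, forall k, K k -> cabs (p k.1 k.2) <= M.

Record generator_symbol (P : R -> R.-spker 'rV[R]_d ~> 'rV[R]_d)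
    (p : 'rV[R]_d -> 'rV[R]_d -> R[i]) : Prop := GeneratorSymbol {
  symbol_locally_bounded : locally_bounded p ;
  symbol_levy_khinchine : forall x, exists a b nu,
    [/\ nonneg_definite a, levy_measure nu & p x = levy_khinchine a b nu] ;
  symbol_generator : forall u g, test_function u -> generator P u g ->
    forall x, (g x)%:C = - pdo p u x }.

End symbol.

Section orlicz.
Context {R : realType}.

Record young_function (Phi : R -> R) : Prop := YoungFunction {
  young_convex : @convex_function R R^o setT Phi ;
  young_even : forall x, Phi (- x) = Phi x ;
  young_0 : Phi 0 = 0 ;
  young_pinfty : Phi x @[x --> +oo] --> +oo }.

Definition young_conjugate (Phi : R -> R) (y : R) : \bar R :=
  ereal_sup [set (x * `|y| - Phi x)%:E | x in [set x | 0 <= x]].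

Definition orlicz_norm disp (T : measurableType disp)
    (mu : {measure set T -> \bar R}) (Phi : R -> R) (f : T -> R) : \bar R :=
  ereal_sup [set (\int[mu]_x `|f x * g x|%:E)%E | g in
    [set g : T -> R | measurable_fun setT g /\
      (\int[mu]_x young_conjugate Phi (g x) <= 1)%E]].

End orlicz.

Section conditions.
Context {R : realType} {d : nat}.
Variable P : R -> R.-spker 'rV[R]_d ~> 'rV[R]_d.
Local Open Scope ereal_scope.

(* K is taken nonempty because the supremum of the empty set is -oo in \bar R. *)
Definition loc_unif_abs_continuous (t : R) : Prop :=
  forall K : set 'rV[R]_d, compact K -> K !=set0 ->
  ereal_sup [set ereal_sup [set P t z B | z in K] | B in
    [set B | measurable B /\ lebesgue_rV d B <= eps%:E]]
    @[eps --> (0:R)^'+] --> 0.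

Definition orlicz_bounded (t : R) : Prop := exists Phi : R -> R,
  [/\ young_function Phi,
      forall x, (0 <= Phi x)%R,
      forall x, Phi x = 0%R <-> x = 0%R &
      forall K : set 'rV[R]_d, compact K -> exists C : R,
        forall u, test_function u ->
          ereal_sup [set `|semigroup_op P t u x|%:E | x in K] <=
          C%:E * orlicz_norm (lebesgue_rV d) Phi u].

End conditions.

(* Main.v *)
(* A rescaled bump [u l := u (l * _)] has a Fourier transform concentrating at 0
   as [l] tends to 0.  The Levy-Khinchine form gives [p x xi --> p x 0 = 0] as
   [xi] tends to 0, so with the quadratic bound on [p] the functions [A (u l)]
   are uniformly bounded and tend to 0 pointwise.  Letting [l] tend to 0 in
   [T_t (u l) - u l = int_0^t T_s (A (u l)) ds] yields [T_t 1 = 1].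
   Conservativeness and the continuity of [T_t f] for [f] vanishing at infinity
   make the measures [P t z], for [z] near a given point, uniformly tight; under
   condition (1) they are thus uniformly continuous from above at the empty set.
   Hence the Borel sets [B] for which [z |-> P t z B] is continuous form a
   lambda-system containing the open sets, and uniform approximation of bounded
   Borel functions by simple ones concludes.
   Condition (2) implies condition (1) on bounded sets: Young's inequality gives
   [|u|_Phi <= l + l * Phi (1 / l) * int u] for test functions [0 <= u <= 1] and
   [l > 0], which passes to open sets by monotone approximation and to Borel sets
   by outer regularity. *)

Require Import Defs.
From HB Require Import structures.
From mathcomp Require Import all_boot all_order all_algebra.
From mathcomp Require Import complex.
From mathcomp Require Import all_classical all_reals all_analysis.
From mathcomp Require Import measurable_realfun ring lra.

Set Implicit Arguments.
Unset Strict Implicit.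
Unset Printing Implicit Defensive.

Import Order.TTheory GRing.Theory Num.Theory.
Import numFieldNormedType.Exports.

Local Open Scope classical_set_scope.
Local Open Scope ring_scope.

(** * Smooth bumps *)

(** The bumps are explicit because the uniform bound on [A (u l)] needs a pointwise bound on their
    Fourier transforms that stays integrable after multiplication by [enorm xi ^+ 2] and scales
    correctly in [l]. Products over the coordinates reduce this to integration by parts on the line,
    in step with the iterated product defining the measure. Decay of order 4 in each coordinate is
    the target: two powers leave a Poisson kernel, whose integral does not depend on [l], and the
    other two absorb the quadratic growth of the symbol and produce the factor [l ^+ 2]. The bumps
    are not normalised; they tend to a positive constant, which linearity of [T_t] divides out. The
    same smooth functions later approximate open sets. Lebesgue measure is infinite, so decreasing
    sets with empty intersection need not have small measure. Both conditions are therefore reduced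
    to one statement about subsets of a box, [locally_equi_absolutely_continuous], and tightness
    disposes of the complement of the box. *)

Section flat_functions.
Context {R : realType}.
Implicit Types (q : {poly R}) (x y a b c : R).

(** A first-order remainder estimate, for the places that the rules of calculus do not reach: [flat]
    at the origin, a function of one coordinate in the direction of another, and the orbits of the
    semigroup in time. *)
Lemma is_derive_squeeze (V : normedModType R) (f : V -> R) (x v : V) (l : R) :
  (forall e : R, 0 < e -> exists2 r : R, 0 < r & forall h : R, h != 0 -> `|h| < r ->
    `|f (h *: v + x) - f x - h * l| <= e * `|h|) -> is_derive x v f l.
Proof.
move=> fl.
have fxl : h^-1 *: ((f \o shift x) (h *: v) - f x) @[h --> 0^'] --> l.
  apply/cvgrPdist_le => e /fl[r r0 hr].
  near=> h; have h0 : h != 0 by near: h; exact: nbhs_dnbhs_neq.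
  rewrite /= distrC -(@ler_pM2l _ `|h|) ?normr_gt0//.
  rewrite -normrM mulrBr /GRing.scale/= mulrA divff// mul1r.
  rewrite [leRHS]mulrC hr//; near: h; exact: dnbhs0_lt.
apply: DeriveDef; first by apply/cvg_ex; exists l.
exact/cvg_lim.
Unshelve. all: by end_near. Qed.

(* The functions [flat q] are closed under differentiation and contain
   [exp(-1/x) 1_{x > 0}]. *)
Definition flat q x : R := if 0 < x then q.[x^-1] * expR (- x^-1) else 0.

Lemma flat_le0 q x : x <= 0 -> flat q x = 0.
Proof. by rewrite /flat leNgt => /negbTE ->. Qed.

(** The exponential dominates the single term of degree [n + 2] of its series, whence the
    factorial. *)
Lemma exprn_expRN_bound n : exists2 M : R, 0 < M &
  forall y, 0 < y -> y ^+ n * expR (- y) <= M * (y ^- 2).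
Proof.
exists (n.+2`!)%:R; first by rewrite ltr0n fact_gt0.
move=> y y0; rewrite ler_pdivlMr ?exprn_gt0// mulrAC -exprD addn2 expRN.
rewrite ler_pdivrMr ?expR_gt0// -ler_pdivrMl ?ltr0n ?fact_gt0// mulrC.
by apply: le_trans (expR_ge1Dxn n.+1 (ltW y0)); rewrite lerDr.
Qed.

Lemma flat_bound q : exists2 M : R, 0 < M & forall x, `|flat q x| <= M * x ^+ 2.
Proof.
have [N hN] : exists N : nat -> R,
    forall n, 0 < N n /\ forall y, 0 < y -> y ^+ n * expR (- y) <= N n * y ^- 2.
  pose N n := s2val (cid2 (exprn_expRN_bound n)).
  by exists N => n; rewrite /N; case: cid2.
(* The summand 1 keeps the constant positive even for [q = 0]. *)
exists (1 + \sum_(i < size q) `|q`_i| * N i).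
  by rewrite ltr_pwDl// sumr_ge0// => i _; rewrite mulr_ge0// ltW// (hN i).1.
move=> x; rewrite /flat; case: ifPn => [x0|_]; last first.
  rewrite normr0 mulr_ge0 ?sqr_ge0// addr_ge0// sumr_ge0// => i _.
  by rewrite mulr_ge0// ltW// (hN i).1.
rewrite horner_coef normrM (ger0_norm (expR_ge0 _)) mulrDl ler_wpDl ?mul1r ?sqr_ge0//.
rewrite (le_trans (ler_wpM2r (expR_ge0 _) (ler_norm_sum _ _ _)))//.
rewrite !mulr_suml ler_sum// => i _; rewrite normrM -!mulrA ler_wpM2l//.
have xV0 : 0 < x^-1 by rewrite invr_gt0.
rewrite ger0_norm ?(exprn_ge0 _ (ltW xV0))//.
by rewrite (le_trans ((hN i).2 _ xV0))// exprVn invrK.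
Qed.

(** With [y = x^-1], the chain rule contributes [- y ^+ 2], and [q(y) exp(-y)] has derivative
    [(q' - q)(y) exp(-y)] in [y]. *)
Definition flat_deriv q : {poly R} := 'X^2 * (q - q^`()).

Lemma is_derive_flat q x : is_derive x 1 (flat q) (flat (flat_deriv q) x).
Proof.
have [x0|x0|->] := ltgtP x 0.
- apply: (@near_eq_is_derive _ _ _ (cst 0)).
    by near=> y; rewrite flat_le0// ltW//; near: y; exact: lt_nbhsl.
  by rewrite flat_le0 ?ltW//; exact: is_derive_cst.
- apply: (@near_eq_is_derive _ _ _ (fun y => q.[y^-1] * expR (- y^-1))).
    by near=> y; rewrite /flat ifT//; near: y; exact: lt_nbhsr.
  have dV : is_derive x 1 (fun y : R => y^-1) (- x ^- 2).
    apply: is_derive_eq; first exact: (@is_deriveV _ id x _ 1 (lt0r_neq0 x0)).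
    by rewrite /GRing.scale/= mulr1.
  have dq : is_derive x 1 (fun y : R => q.[y^-1]) (q^`().[x^-1] * (- x ^- 2)).
    exact: (@is_derive1_comp _ (horner q) _ x _ _ _ dV).
  have dN : is_derive x 1 (fun y : R => - y^-1) (x ^- 2).
    by have := is_deriveN dV; rewrite opprK.
  have de s := @is_derive1_comp _ expR _ x s _ ^~ dN.
  apply: (is_derive_eq (is_deriveM dq (de _ (is_derive_expR _)))).
  rewrite /flat x0 /flat_deriv /GRing.scale/= hornerM hornerXn hornerD hornerN.
  by rewrite exprVn; ring.
(* At the origin the quadratic bound forces derivative 0: [M * h ^+ 2] is at most [e * |h|] once
   [|h| < e / M]. *)
- have [M M0 hM] := flat_bound q.
  apply: is_derive_squeeze => e e0; exists (e / M); first by rewrite divr_gt0.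
  move=> h _; rewrite ltr_pdivlMr// => he.
  rewrite scaler1 addr0 !(@flat_le0 _ 0)// mulr0 !subr0 (le_trans (hM _))//.
  by rewrite -real_normK ?num_real// expr2 mulrA ler_wpM2r// mulrC ltW.
Unshelve. all: by end_near. Qed.

Lemma continuous_flat q : continuous (flat q).
Proof.
move=> x; apply/differentiable_continuous/derivable1_diffP.
by apply: ex_derive; exact: is_derive_flat.
Qed.

Lemma flat1E x : flat 1 x = if 0 < x then expR (- x^-1) else 0.
Proof. by rewrite /flat hornerC mul1r. Qed.

Lemma flat1_ge0 x : 0 <= flat 1 x.
Proof. by rewrite flat1E; case: ifPn => // _; exact: expR_ge0. Qed.

Lemma flat1_gt0 x : (0 < flat 1 x) = (0 < x).
Proof. by rewrite flat1E; case: (ltP 0 x) => _; rewrite ?ltxx ?expR_gt0. Qed.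

Lemma flat1_le1 x : flat 1 x <= 1.
Proof.
by rewrite flat1E; case: (ltP 0 x) => // x0; rewrite expR_le1 oppr_le0 invr_ge0 ltW.
Qed.

End flat_functions.

Section continuous_topological.
Context {R : realType} {T : topologicalType}.
Implicit Types f g : T -> R.

Lemma continuous_funD f g : continuous f -> continuous g ->
  continuous (fun x => f x + g x).
Proof. by move=> cf cg x; apply: cvgD; [exact: cf|exact: cg]. Qed.

Lemma continuous_funM f g : continuous f -> continuous g ->
  continuous (fun x => f x * g x).
Proof. by move=> cf cg x; apply: cvgM; [exact: cf|exact: cg]. Qed.

Lemma continuous_funB f g : continuous f -> continuous g ->
  continuous (fun x => f x - g x).
Proof. by move=> cf cg x; apply: cvgB; [exact: cf|exact: cg]. Qed.

Lemma continuous_compT (U V : topologicalType) (f : T -> U) (g : U -> V) :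
  continuous f -> continuous g -> continuous (fun x => g (f x)).
Proof. by move=> cf cg x; apply: continuous_comp; [exact: cf|exact: cg]. Qed.

End continuous_topological.

(** * An algebra of functions stable under partial derivatives *)

Section flat_algebra.
Context {R : realType} {d : nat}.
Implicit Types (u v : 'rV[R]_d -> R) (x : 'rV[R]_d).

(** A syntactic class: differentiability along each axis, with derivative in the class, follows by
    induction on the construction, and this gives all iterated partial derivatives at once. *)
Inductive flat_alg : ('rV[R]_d -> R) -> Prop :=
| flat_alg_flat q i a c : flat_alg (fun x => flat q (a * x ord0 i + c))
| flat_alg_cst c : flat_alg (fun=> c)
| flat_algD u v : flat_alg u -> flat_alg v -> flat_alg (fun x => u x + v x)
| flat_algM u v : flat_alg u -> flat_alg v -> flat_alg (fun x => u x * v x).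

Lemma flat_alg_prod (I : Type) (s : seq I) (F : I -> 'rV[R]_d -> R) :
  (forall i, flat_alg (F i)) -> flat_alg (fun x => \prod_(i <- s) F i x).
Proof.
move=> aF; elim: s => [|i s IH].
  rewrite (_ : (fun x => _) = (fun=> 1)); first exact: flat_alg_cst.
  by apply/funext => x; rewrite big_nil.
rewrite (_ : (fun x => _) = (fun x => F i x * \prod_(i <- s) F i x)).
  exact: flat_algM.
by apply/funext => x; rewrite big_cons.
Qed.

Lemma continuous_flat_alg u : flat_alg u -> continuous u.
Proof.
elim => [q i a c|c|f g _ cf _ cg|f g _ cf _ cg].
- have ca : continuous (fun y : R => a * y + c).
    by move=> y; apply: cvgD; [apply: cvgM; [exact: cvg_cst|exact: cvg_id]|exact: cvg_cst].
  have cc : continuous (fun x : 'rV[R]_d => x ord0 i) by exact: coord_continuous.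
  apply: (continuous_compT cc (g := fun y => flat q (a * y + c))).
  exact: (continuous_compT ca (@continuous_flat R q)).
- exact: cst_continuous.
- exact: continuous_funD.
- exact: continuous_funM.
Qed.

Lemma is_derive_coord (g : R -> R) (dg : R) x (i j : 'I_d) :
  is_derive (x ord0 j) 1 g dg ->
  is_derive x (delta_mx ord0 i) (fun y : 'rV[R]_d => g (y ord0 j))
    ((i == j)%:R * dg).
Proof.
move=> [gd <-]; have [ij|ij] := eqVneq i j.
  rewrite mul1r ij.
  have E : (fun h : R => h^-1 *: (((fun y : 'rV[R]_d => g (y ord0 j)) \o shift x)
      (h *: delta_mx ord0 j) - g (x ord0 j))) =
      (fun h : R => h^-1 *: ((g \o shift (x ord0 j)) (h *: 1) - g (x ord0 j))).
    by apply/funext => h /=; rewrite !mxE !eqxx /GRing.scale/= mulr1.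
  by apply: DeriveDef; rewrite /derivable /derive E.
rewrite mul0r; apply: is_derive_squeeze => e e0; exists 1 => // h _ _.
have -> : (h *: (delta_mx ord0 i : 'rV[R]_d) + x) ord0 j = x ord0 j.
  by rewrite !mxE eqxx (eq_sym j) (negbTE ij) andbF mulr0n mulr0 add0r.
rewrite subrr mulr0 subr0 normr0.
by rewrite mulr_ge0// ltW.
Qed.

Lemma flat_alg_derive (i : 'I_d) u : flat_alg u ->
  exists2 v, flat_alg v & forall x, is_derive x (delta_mx ord0 i) u (v x).
Proof.
elim => [q j a c|c|f g _ [f' af' df] _ [g' ag' dg]|f g af [f' af' df] ag [g' ag' dg]].
- exists (fun x => ((i == j)%:R * a) * flat (flat_deriv q) (a * x ord0 j + c)).
    by apply: flat_algM; [exact: flat_alg_cst|exact: flat_alg_flat].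
  move=> x; rewrite -mulrA; apply: (@is_derive_coord (fun y => flat q (a * y + c))).
  have da : is_derive (x ord0 j) 1 (fun y : R => a * y + c) a.
    have := is_deriveD (is_deriveZ a (is_derive_id (x ord0 j) 1))
      (is_derive_cst c (x ord0 j) 1).
    by rewrite addr0 /GRing.scale/= mulr1.
  have := @is_derive1_comp _ (flat q) _ _ _ _ (is_derive_flat q _) da.
  by rewrite mulrC.
- by exists (fun=> 0); [exact: flat_alg_cst|move=> x; exact: is_derive_cst].
- exists (fun x => f' x + g' x); first exact: flat_algD.
  by move=> x; have := is_deriveD (df x) (dg x).
- exists (fun x => f x * g' x + g x * f' x).
    by apply: flat_algD; exact: flat_algM.
  by move=> x; have := is_deriveM (df x) (dg x).
Qed.

Lemma flat_alg_smooth u : flat_alg u -> smooth u.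
Proof.
move=> au s; have : flat_alg (partials s u).
  elim: s => //= i s /(flat_alg_derive i)[v av dv].
  by rewrite (_ : 'D_ _ _ = v)//; apply/funext => x; exact: derive_val.
move=> as_; split; first exact: continuous_flat_alg.
by move=> i x; have [v _ dv] := flat_alg_derive i as_; exact: ex_derive.
Qed.

Lemma flat_alg_test_function u (r : R) : flat_alg u ->
  (forall x, r < `|x| -> u x = 0) -> test_function u.
Proof.
move=> au ur; split; first exact: flat_alg_smooth.
have sub : [set x | u x != 0] `<=` closed_ball_ Num.norm (0 : 'rV[R]_d) r.
  move=> x /= ux; rewrite /closed_ball_/= sub0r normrN leNgt.
  by apply: contra ux => /ur ->.
have cl : closure [set x | u x != 0] `<=` closed_ball_ Num.norm (0 : 'rV[R]_d) r.
  by move=> x /(closure_subset sub); apply: closed_closed_ball_.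
apply: bounded_closed_compact; last exact: closed_closure.
exists r; split; first exact: num_real.
move=> M rM x /cl; rewrite /closed_ball_/= sub0r normrN => xr.
by rewrite (le_trans xr)// ltW.
Qed.

(** For [l > 0] it is supported on a cube, the ball of radius [l^-1] of the maximum norm. At [l = 0]
    it degenerates to a positive constant, the limit of the rescaled bumps. *)
Definition flat_bump (l : R) (c x : 'rV[R]_d) : R :=
  \prod_i (flat 1 (1 + l * (x ord0 i - c ord0 i)) *
           flat 1 (1 - l * (x ord0 i - c ord0 i))).

Lemma flat_bump_flat_alg l c : flat_alg (flat_bump l c).
Proof.
apply: flat_alg_prod => i; apply: flat_algM.
  rewrite (_ : (fun x => _) =
      (fun x : 'rV[R]_d => flat 1 (l * x ord0 i + (1 - l * c ord0 i)))).
    exact: flat_alg_flat.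
  by apply/funext => x; congr flat; ring.
rewrite (_ : (fun x => _) =
    (fun x : 'rV[R]_d => flat 1 (- l * x ord0 i + (1 + l * c ord0 i)))).
  exact: flat_alg_flat.
by apply/funext => x; congr flat; ring.
Qed.

Lemma flat_bump_ge0 l c x : 0 <= flat_bump l c x.
Proof. by apply: prodr_ge0 => i _; rewrite mulr_ge0 ?flat1_ge0. Qed.

Lemma flat_bump_le1 l c x : flat_bump l c x <= 1.
Proof.
rewrite -[leRHS](@big1_eq _ _ *%R _ (index_enum 'I_d) xpredT).
apply: ler_prod => i _; rewrite mulr_ge0 ?flat1_ge0//=.
by rewrite mulr_ile1 ?flat1_ge0 ?flat1_le1.
Qed.

Lemma rV_norm_coord (x : 'rV[R]_d) i : `|x ord0 i| <= `|x|.
Proof. by rewrite -[leRHS]/(mx_norm x) mx_normrE; exact: (le_bigmax _ _ (ord0, i)). Qed.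

Lemma rV_norm_le (x : 'rV[R]_d) (r : R) : 0 <= r ->
  (forall i, `|x ord0 i| <= r) -> `|x| <= r.
Proof. by move=> r0 xr; rewrite -[leLHS]/(mx_norm x) mx_normrE; apply: bigmax_le => // -[i j] _; rewrite (ord1 i). Qed.

Lemma rV_norm_lt (x : 'rV[R]_d) (r : R) : 0 < r ->
  (forall i, `|x ord0 i| < r) -> `|x| < r.
Proof. by move=> r0 xr; rewrite -[ltLHS]/(mx_norm x) mx_normrE; apply: bigmax_lt => // -[i j] _; rewrite (ord1 i). Qed.

Lemma flat_bump_gt0 l c x : 0 < l -> (0 < flat_bump l c x) = (`|x - c| < l^-1).
Proof.
move=> l0; have E i : (0 < flat 1 (1 + l * (x ord0 i - c ord0 i)) *
    flat 1 (1 - l * (x ord0 i - c ord0 i))) = (`|(x - c) ord0 i| < l^-1).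
  rewrite !mxE; set y := x ord0 i - c ord0 i.
  have -> : (`|y| < l^-1) = (`|l * y| < 1).
    by rewrite normrM (gtr0_norm l0) mulrC -ltr_pdivlMr// mul1r.
  rewrite ltr_norml; apply/idP/idP => [|h]; last first.
    by rewrite mulr_gt0// flat1_gt0; lra.
  have := flat1_ge0 (1 + l * y).
  rewrite le_eqVlt => /predU1P[<-|h1]; first by rewrite mul0r ltxx.
  by rewrite pmulr_rgt0//; move: h1; rewrite !flat1_gt0 => ? ?; lra.
apply/idP/idP => [h|h]; last first.
  apply: prodr_gt0 => i _; rewrite E; apply: le_lt_trans h.
  exact: rV_norm_coord.
have {}E i : `|(x - c) ord0 i| < l^-1.
  rewrite -E lt0r mulr_ge0 ?flat1_ge0// andbT; apply/eqP => i0.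
  by move: h; rewrite /flat_bump (bigD1 i)//= i0 mul0r ltxx.
by apply: rV_norm_lt; rewrite ?invr_gt0.
Qed.

End flat_algebra.

(** * Integrals on ['rV[R]_d] *)

Section integral_without_measurability.
Context d (T : measurableType d) (R : realType).
Variable mu : {measure set T -> \bar R}.
Variable D : set T.

(** The integral of a nonnegative function is a supremum over simple minorants, hence monotone for
    arbitrary functions. *)
Lemma nonneg_integral_mono (f g : T -> \bar R) :
  (forall x, D x -> (0 <= f x)%E) -> (forall x, D x -> (f x <= g x)%E) ->
  (\int[mu]_(x in D) f x <= \int[mu]_(x in D) g x)%E.
Proof.
move=> f0 fg; have g0 x : D x -> (0 <= g x)%E.
  by move=> Dx; rewrite (le_trans (f0 _ Dx))// fg.
rewrite !ge0_integralE//; apply: ge_ereal_sup => _ [h /= hf] <-.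
apply: ereal_sup_ubound; exists h => // x; apply: le_trans (hf x) _.
by rewrite /patch; case: ifPn => // /[!inE] Dx; exact: fg.
Qed.

(** The integrals of the positive and negative parts both lie in [[0, B]], hence so does the
    absolute value of their difference. Stated for arbitrary [f], so that it applies to integrands
    containing a general symbol. *)
Lemma Rintegral_abs_le (f G : T -> R) (B : R) :
  (forall x, D x -> `|f x| <= G x) ->
  (\int[mu]_(x in D) (G x)%:E <= B%:E)%E ->
  `|\int[mu]_(x in D) f x| <= B.
Proof.
move=> fG GB; rewrite /Rintegral integralE.
have pB : (\int[mu]_(x in D) (fun x => (f x)%:E)^\+%E x <= B%:E)%E.
  apply: le_trans GB; apply: nonneg_integral_mono => x Dx; first exact: funepos_ge0.
  rewrite funeposE /maxe; case: ifPn => _; rewrite lee_fin.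
    by rewrite (le_trans _ (fG _ Dx)).
  by rewrite (le_trans (ler_norm _))// fG.
have nB : (\int[mu]_(x in D) (fun x => (f x)%:E)^\-%E x <= B%:E)%E.
  apply: le_trans GB; apply: nonneg_integral_mono => x Dx; first exact: funeneg_ge0.
  rewrite funenegE /maxe; case: ifPn => _; rewrite lee_fin.
    by rewrite (le_trans _ (fG _ Dx)).
  by rewrite (le_trans (ler_norm _))// normrN fG.
have p0 : (0 <= \int[mu]_(x in D) (fun x => (f x)%:E)^\+%E x)%E.
  by apply: integral_ge0 => x _; exact: funepos_ge0.
have n0 : (0 <= \int[mu]_(x in D) (fun x => (f x)%:E)^\-%E x)%E.
  by apply: integral_ge0 => x _; exact: funeneg_ge0.
move: p0 n0 pB nB.
case: (\int[mu]_(x in D) _ x)%E => [a| |]//=.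
case: (\int[mu]_(x in D) _ x)%E => [b| |]//=.
rewrite !lee_fin => a0 b0 aB bB.
by rewrite ler_norml; apply/andP; split; lra.
Qed.

End integral_without_measurability.

Lemma Rdominated_cvg d (T : measurableType d) (R : realType)
    (mu : {measure set T -> \bar R}) (D : set T) (f_ : nat -> T -> R) (f g : T -> R) :
  measurable D ->
  (forall n, measurable_fun D (f_ n)) ->
  (forall x, D x -> f_ ^~ x @ \oo --> f x) ->
  mu.-integrable D (EFin \o g) ->
  (forall n x, D x -> `|f_ n x| <= g x) ->
  \int[mu]_(x in D) f_ n x @[n --> \oo] --> \int[mu]_(x in D) f x.
Proof.
move=> mD mf ff ig fg.
have mf' n : measurable_fun D (EFin \o f_ n) by exact/measurable_EFinP.
have ff' x : D x -> (EFin \o f_ n) x @[n --> \oo] --> (EFin \o f) x.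
  by move=> Dx; apply/fine_cvgP; split; [exact: nearW|exact: ff].
have fg' n x : D x -> (`|(EFin \o f_ n) x| <= (EFin \o g) x)%E.
  by move=> Dx; rewrite /= lee_fin fg.
have ifn n : mu.-integrable D (EFin \o f_ n).
  apply: le_integrable ig => // x Dx; rewrite (le_trans (fg' n x Dx))//=.
  by rewrite lee_fin ler_norm.
have if_ : mu.-integrable D (EFin \o f).
  have mfl : measurable_fun D (EFin \o f) by exact: (emeasurable_fun_cvg (fun n => EFin \o f_ n)).
  apply: le_integrable ig => // x Dx; rewrite /= lee_fin (le_trans _ (ler_norm _))//.
  apply: (cvgr_to_le (cvg_norm (ff _ Dx))).
  by apply: nearW => n; exact: fg.
have := @dominated_cvg _ _ _ mu _ mD _ (EFin \o f) (EFin \o g) mf' ff'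
  (fun x Dx => erefl) ig fg'.
rewrite /Rintegral -[X in _ --> X]fineK; last exact: integrable_fin_num.
by move=> /fine_cvgP[].
Qed.

(** * Lebesgue measure on boxes and splitting off the last coordinate *)

Section lebesgue_rV_product.
Context {R : realType}.

Definition rV_box d (r : R) : set 'rV[R]_d := [set x | forall i, - r < x ord0 i <= r].

Arguments rV_box : clear implicits.

Lemma measurable_rV_box d r : measurable (rV_box d r).
Proof.
rewrite (_ : rV_box d r = \bigcap_(i in [set: 'I_d])
    ((fun x : 'rV[R]_d => x ord0 i) @^-1` `]-r, r])); last first.
  apply/seteqP; split => x /= h i; first by move=> _ /=; rewrite in_itv/= h.
  by have := h i I; rewrite /= in_itv.
apply: fin_bigcap_measurable => // i _.
by rewrite -[X in measurable X]setTI; exact: measurable_coord.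
Qed.

Lemma lebesgue_rV_box_lty d r : 0 <= r -> (lebesgue_rV d (rV_box d r) < +oo)%E.
Proof.
move=> r0; pose a : 'rV[R]_d := \row_i (- r); pose b : 'rV[R]_d := \row_i r.
rewrite (_ : rV_box d r = [set x | forall i, a ord0 i < x ord0 i <= b ord0 i]).
  by rewrite lebesgue_rV_box ?ltry// => i; rewrite !mxE; lra.
by apply/seteqP; split => x /= h i; have := h i; rewrite !mxE.
Qed.

Lemma rV_box_cover d (x : 'rV[R]_d) : exists n : nat, forall m, (n <= m)%N ->
  rV_box d m%:R x.
Proof.
exists (Num.bound `|x|) => m nm i.
have xm : `|x| < m%:R.
  by rewrite (lt_le_trans (archi_boundP _))// ler_nat.
have := le_lt_trans (rV_norm_coord x i) xm; rewrite ltr_norml => /andP[-> /ltW ->].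
by [].
Qed.

Lemma sigma_finite_lebesgue_rV d : sigma_finite setT (@lebesgue_rV R d).
Proof.
exists (fun n => rV_box d n%:R); last first.
  by move=> n; split; [exact: measurable_rV_box|exact: lebesgue_rV_box_lty].
apply/seteqP; split => // x _; have [n xn] := rV_box_cover x.
by exists n => //; exact: xn.
Qed.

(* A copy of [lebesgue_rV] whose sigma-finiteness is declared, for Fubini. *)
Definition leb_rV d : set 'rV[R]_d -> \bar R := lebesgue_rV d.
Arguments leb_rV : clear implicits.

HB.instance Definition _ d := Measure.on (leb_rV d).
HB.instance Definition _ d :=
  Measure_isSigmaFinite.Build _ _ _ (leb_rV d) (@sigma_finite_lebesgue_rV d).

Lemma ge0_integral_lebesgue_rVS d (f : 'rV[R]_d.+1 -> \bar R) :
  measurable_fun setT f -> (forall x, (0 <= f x)%E) ->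
  (\int[lebesgue_rV d.+1]_x f x =
   \int[lebesgue_rV d]_x \int[lebesgue_measure]_y f (rcons_rV (x, y)))%E.
Proof.
move=> mf f0.
transitivity (\int[(leb_rV d \x lebesgue_measure)%E]_z (f \o @rcons_rV R d) z)%E.
  have mphi : measurable_fun [set: 'rV[R]_d * measurableTypeR R] (@rcons_rV R d) :=
    @measurable_rcons_rV R d.
  have H := @ge0_integral_pushforward _ _ _ _ R _ mphi
    (leb_rV d \x lebesgue_measure)%E setT f measurableT mf (fun x _ => f0 x).
  rewrite preimage_setT in H; rewrite -H.
  by apply: eq_measure_integral.
rewrite fubini_tonelli1//=.
by apply: measurableT_comp => //; exact: measurable_rcons_rV.
Qed.

Lemma integrable_prod_mul d (f : 'rV[R]_d -> R) (g : R -> R) :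
  (leb_rV d).-integrable setT (EFin \o f) ->
  lebesgue_measure.-integrable setT (EFin \o g) ->
  (leb_rV d \x lebesgue_measure)%E.-integrable setT
    (fun z : 'rV[R]_d * R => (f z.1 * g z.2)%:E).
Proof.
move=> fi gi.
have mf : measurable_fun setT f by move/measurable_int : fi => /measurable_EFinP.
have mg : measurable_fun setT g by move/measurable_int : gi => /measurable_EFinP.
apply/integrable12ltyP.
  apply/measurable_EFinP; apply: measurable_funM.
    exact: measurableT_comp mf measurable_fst.
  exact: measurableT_comp mg measurable_snd.
move/integrableP: (fi) => [_ foo]; move/integrableP: (gi) => [_ goo].
under eq_integral => x _.
  under eq_integral => y _ do rewrite /= normrM EFinM.
  rewrite ge0_integralZl//; last first.
    by apply/measurable_EFinP; exact: measurableT_comp.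
  over.
rewrite /= ge0_integralZr//; first last.
- by apply: integral_ge0.
- by apply/measurable_EFinP; exact: measurableT_comp.
by rewrite lte_mul_pinfty// ?integral_ge0// ge0_fin_numE// integral_ge0.
Qed.

Lemma Rintegral_prod_mul d (f : 'rV[R]_d -> R) (g : R -> R) :
  (leb_rV d).-integrable setT (EFin \o f) ->
  lebesgue_measure.-integrable setT (EFin \o g) ->
  (\int[(leb_rV d \x lebesgue_measure)%E]_z (f z.1 * g z.2)%:E =
  (\int[lebesgue_rV d]_x f x * \int[lebesgue_measure]_y g y)%:E)%E.
Proof.
move=> fi gi; rewrite -integral12_prod_meas1; last exact: integrable_prod_mul.
under eq_integral => x _.
  rewrite /fubini_F; under eq_integral => y _ do rewrite /= EFinM.
  rewrite integralZl//.
  rewrite -[X in (_ * X)%E]fineK; last exact: integrable_fin_num.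
  over.
rewrite /= integralZr//.
by rewrite /Rintegral EFinM; congr (_ * _)%E; rewrite fineK//; exact: integrable_fin_num.
Qed.

(** The difference of two products is the shape of the addition formula for the cosine. *)
Lemma Rintegral_lebesgue_rVS d (F : 'rV[R]_d.+1 -> R)
    (f1 f2 : 'rV[R]_d -> R) (g1 g2 : R -> R) :
  measurable_fun setT F ->
  (forall x y, F (rcons_rV (x, y)) = f1 x * g1 y - f2 x * g2 y) ->
  (lebesgue_rV d).-integrable setT (EFin \o f1) ->
  (lebesgue_rV d).-integrable setT (EFin \o f2) ->
  lebesgue_measure.-integrable setT (EFin \o g1) ->
  lebesgue_measure.-integrable setT (EFin \o g2) ->
  \int[lebesgue_rV d.+1]_x F x =
   \int[lebesgue_rV d]_x f1 x * \int[lebesgue_measure]_y g1 y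
   - \int[lebesgue_rV d]_x f2 x * \int[lebesgue_measure]_y g2 y.
Proof.
move=> mF FE if1 if2 ig1 ig2; rewrite /Rintegral.
have i1 := integrable_prod_mul if1 ig1; have i2 := integrable_prod_mul if2 ig2.
have E : EFin \o F \o @rcons_rV R d =
    (fun z => (f1 z.1 * g1 z.2)%:E - (f2 z.1 * g2 z.2)%:E)%E.
  by apply/funext => -[x y] /=; rewrite FE EFinB.
transitivity (fine (\int[(leb_rV d \x lebesgue_measure)%E]_z
    (EFin \o F \o @rcons_rV R d) z)%E).
  have mphi : measurable_fun [set: 'rV[R]_d * measurableTypeR R] (@rcons_rV R d) :=
    @measurable_rcons_rV R d.
  have mF' : measurable_fun [set: 'rV[R]_d.+1] (EFin \o F) by exact/measurable_EFinP.
  have iF : (leb_rV d \x lebesgue_measure)%E.-integrable (@rcons_rV R d @^-1` setT)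
      ((EFin \o F) \o @rcons_rV R d).
    by rewrite preimage_setT E; exact: integrableB.
  have H := @integral_pushforward _ _ _ _ R _ mphi
    (leb_rV d \x lebesgue_measure)%E setT (EFin \o F) mF' iF measurableT.
  rewrite preimage_setT in H; rewrite -H; congr fine.
rewrite E integralB//.
by rewrite !Rintegral_prod_mul.
Qed.

End lebesgue_rV_product.

Lemma RintegrableZl d (T : measurableType d) (R : realType)
    (mu : {measure set T -> \bar R}) (D : set T) (k : R) (f : T -> R) :
  measurable D -> mu.-integrable D (EFin \o f) ->
  mu.-integrable D (EFin \o (fun x => k * f x)).
Proof.
move=> mD fi; have := integrableZl mD k fi.
by apply: eq_integrable => // x _; rewrite /= EFinM.
Qed.

Lemma RintegrableB d (T : measurableType d) (R : realType)
    (mu : {measure set T -> \bar R}) (D : set T) (f g : T -> R) :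
  measurable D -> mu.-integrable D (EFin \o f) -> mu.-integrable D (EFin \o g) ->
  mu.-integrable D (EFin \o (fun x => f x - g x)).
Proof.
move=> mD fi gi; have := integrableB mD fi gi.
by apply: eq_integrable => // x _; rewrite /= EFinB.
Qed.

(** * Oscillatory integrals on the line *)

Section oscillatory_line.
Context {R : realType}.
Implicit Types (q r : {poly R}) (l x y xi theta : R).
Local Notation leb := (@lebesgue_measure R).

(** [wave l 1 1] is the one-dimensional factor of a bump; general polynomials are needed because
    integration by parts differentiates either factor. *)
Definition wave l q r x : R := flat q (1 + l * x) * flat r (1 - l * x).

Lemma wave_out l q r x : 0 < l -> l^-1 <= `|x| -> wave l q r x = 0.
Proof.
move=> l0; rewrite -[l^-1]mulr1 ler_pdivrMl// -{1}(gtr0_norm l0) -normrM ler_normr.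
by rewrite /wave => /orP[h|h]; [rewrite [flat r _]flat_le0 ?mulr0|
  rewrite [flat q _]flat_le0 ?mul0r]; lra.
Qed.

Lemma is_derive_wave l q r x : is_derive x 1 (wave l q r)
  (l * wave l (flat_deriv q) r x - l * wave l q (flat_deriv r) x).
Proof.
have d1 : is_derive x 1 (fun y : R => 1 + l * y) l.
  have := is_deriveD (is_derive_cst (1 : R) x 1) (is_deriveZ l (is_derive_id x 1)).
  by rewrite add0r /GRing.scale/= mulr1.
have d2 : is_derive x 1 (fun y : R => 1 - l * y) (- l).
  have := is_deriveB (is_derive_cst (1 : R) x 1) (is_deriveZ l (is_derive_id x 1)).
  by rewrite sub0r /GRing.scale/= mulr1.
have f1 := @is_derive1_comp _ (flat q) _ _ _ _ (is_derive_flat q _) d1.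
have f2 := @is_derive1_comp _ (flat r) _ _ _ _ (is_derive_flat r _) d2.
apply: (is_derive_eq (is_deriveM f1 f2)).
by rewrite /wave /GRing.scale/=; ring.
Qed.

Lemma continuous_wave l q r : continuous (wave l q r).
Proof.
move=> x; apply/differentiable_continuous/derivable1_diffP.
by apply: ex_derive; exact: is_derive_wave.
Qed.

(** Uniform in [l]: on the support both arguments [1 + l * x] and [1 - l * x] lie in [[0, 2]], where
    the quadratic bound on [flat] gives the factors [2 ^+ 2]. *)
Lemma wave_bound q r : exists2 M : R, 0 < M &
  forall l x, 0 < l -> `|wave l q r x| <= M.
Proof.
have [M M0 hM] := flat_bound q; have [N N0 hN] := flat_bound r.
exists (M * 2 ^+ 2 * (N * 2 ^+ 2)); first by rewrite !mulr_gt0.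
move=> l x l0; have [xl|xl] := leP l^-1 `|x|.
  by rewrite wave_out// normr0 !mulr_ge0// ltW.
have : `|l * x| < 1 by rewrite normrM (gtr0_norm l0) mulrC -ltr_pdivlMr// mul1r.
rewrite ltr_norml => /andP[lx1 lx2].
have sq y : 0 <= y <= 2 -> y ^+ 2 <= 2 ^+ 2 by move=> ?; nra.
by rewrite normrM ler_pM// (le_trans (hM _), le_trans (hN _))// ler_wpM2l ?(ltW M0)
  ?(ltW N0)// sq//; apply/andP; split; lra.
Qed.

(** The free phase lets a single bound, uniform in [theta], cover the real and imaginary parts of
    the Fourier integral. *)
Definition osc l q r theta xi : R :=
  \int[leb]_x (wave l q r x * cos (x * xi + theta)).

Lemma continuous_phase xi theta : continuous (fun x => cos (x * xi + theta)).
Proof.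
have ca : continuous (fun y : R => y * xi + theta).
  by move=> y; apply: cvgD; [apply: cvgM; [exact: cvg_id|exact: cvg_cst]|exact: cvg_cst].
exact: (continuous_compT ca (@continuous_cos R)).
Qed.

Let itv l : set R := `[- l^-1, l^-1].

Let out_itv l x : ~ itv l x -> l^-1 <= `|x|.
Proof.
by move=> h; rewrite leNgt; apply/negP; rewrite ltr_norml => /andP[h1 h2];
  apply: h; rewrite /itv/= in_itv/= !ltW.
Qed.

Lemma osc_integrable l q r theta xi : 0 < l ->
  leb.-integrable setT (fun x => (wave l q r x * cos (x * xi + theta))%:E).
Proof.
move=> l0; rewrite (_ : (fun x => _) =
    (EFin \o (fun x => wave l q r x * cos (x * xi + theta))) \_ (itv l)).
  apply/(integrable_mkcond _ _).1; first exact: measurable_itv.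
  apply: continuous_compact_integrable; first exact: segment_compact.
  apply: continuous_subspaceT.
  apply: continuous_funM; [exact: continuous_wave|exact: continuous_phase].
apply/funext => x; rewrite patchE; case: ifPn => // /negP; rewrite inE => /out_itv h.
by rewrite wave_out// mul0r.
Qed.

Lemma oscE l q r theta xi : 0 < l ->
  osc l q r theta xi = \int[leb]_(x in itv l) (wave l q r x * cos (x * xi + theta)).
Proof.
move=> l0; rewrite [RHS]Rintegral_mkcond; congr (fine (integral _ _ _)).
apply/funext => x; rewrite patchE; case: ifPn => // /negP; rewrite inE => /out_itv h.
by rewrite wave_out// mul0r.
Qed.

Lemma osc_bound0 q r : exists2 M : R, 0 < M &
  forall l theta xi, 0 < l -> `|osc l q r theta xi| <= M / l.
Proof.
have [M M0 hM] := wave_bound q r; exists (M * 2); first by rewrite mulr_gt0.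
move=> l theta xi l0; rewrite oscE//.
apply: (@Rintegral_abs_le _ _ _ _ _ _ (fun=> M)) => [x _|].
  by rewrite normrM -[leRHS]mulr1 ler_pM// ?cos_max// hM.
rewrite integral_cst//=; last exact: measurable_itv.
rewrite lebesgue_measure_itv/= lte_fin; case: ifPn => _; last first.
  by rewrite mule0 lee_fin !mulr_ge0// ?ltW// invr_gt0.
by rewrite -EFinD -EFinM lee_fin; lra.
Qed.

(* Integration by parts; the phase shift by [pi / 2] turns sines into cosines. *)
Lemma osc_parts l q r theta xi : 0 < l ->
  xi * osc l q r (theta + pi / 2) xi =
  l * (osc l q (flat_deriv r) theta xi - osc l (flat_deriv q) r theta xi).
Proof.
move=> l0.
pose f x := (l * wave l (flat_deriv q) r x - l * wave l q (flat_deriv r) x) *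
   cos (x * xi + theta) + xi * (wave l q r x * cos (x * xi + (theta + pi / 2))).
pose F x := wave l q r x * cos (x * xi + theta).
have dF x : is_derive x 1 F (f x).
  have d1 : is_derive x 1 (fun y : R => y * xi + theta) xi.
    have := is_deriveD (is_deriveZ xi (is_derive_id x 1)) (is_derive_cst theta x 1).
    rewrite addr0 /GRing.scale/= mulr1; apply: near_eq_is_derive.
    by near=> y; rewrite mulrC.
  have d2 := @is_derive1_comp _ cos _ _ _ _ (is_derive_cos _) d1.
  apply: (is_derive_eq (is_deriveM (is_derive_wave l q r x) d2)).
  by rewrite /f /GRing.scale/= addrA cosDpihalf; ring.
have cF x : {for x, continuous F}.
  by apply/differentiable_continuous/derivable1_diffP; exact: ex_derive.
have I1 := osc_integrable (flat_deriv q) r theta xi l0.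
have I2 := osc_integrable q (flat_deriv r) theta xi l0.
have I3 := osc_integrable q r (theta + pi / 2) xi l0.
have cf : continuous f.
  apply: continuous_funD; apply: continuous_funM.
  - rewrite (_ : (fun x => _ - _) = (fun x => l * wave l (flat_deriv q) r x +
      (- l) * wave l q (flat_deriv r) x)).
      by apply: continuous_funD; apply: continuous_funM;
        [exact: cst_continuous|exact: continuous_wave|
         exact: cst_continuous|exact: continuous_wave].
    by apply/funext => x; ring.
  - exact: continuous_phase.
  - exact: cst_continuous.
  - by apply: continuous_funM; [exact: continuous_wave|exact: continuous_phase].
have lV : - l^-1 < l^-1 by rewrite (lt_trans (y := 0))// ?oppr_lt0 invr_gt0.
(* [F] vanishes at both endpoints of its support, so there is no boundary term. *)
have FTC : (\int[leb]_(x in itv l) (f x)%:E = 0)%E.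
  rewrite (@continuous_FTC2 _ f F)//.
  - by rewrite /F !wave_out// ?normrN ?mul0r ?subee// gtr0_norm ?invr_gt0.
  - exact: continuous_subspaceT.
  - split; first by move=> x _; exact: ex_derive.
      by apply: cvg_at_right_filter; exact: cF.
    by apply: cvg_at_left_filter; exact: cF.
  - by move=> x _; rewrite derive1E; exact: derive_val.
have mI : measurable (itv l) by exact: measurable_itv.
have S (g : R -> R) : leb.-integrable setT (fun x => (g x)%:E) ->
    leb.-integrable (itv l) (EFin \o g) by exact: integrableS.
have : \int[leb]_(x in itv l) f x =
    l * osc l (flat_deriv q) r theta xi - l * osc l q (flat_deriv r) theta xi +
    xi * osc l q r (theta + pi / 2) xi.
  have Z k (g : R -> R) : leb.-integrable (itv l) (EFin \o g) ->
      leb.-integrable (itv l) (EFin \o (fun x => k * g x)).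
    exact: RintegrableZl.
  have K1 := Z l _ (S _ I1); have K2 := Z l _ (S _ I2); have K3 := Z xi _ (S _ I3).
  rewrite !oscE// -RintegralZl//; last exact: S.
  rewrite -RintegralZl//; last exact: S.
  rewrite -RintegralZl//; last exact: S.
  rewrite -RintegralB// -RintegralD//; last exact: RintegrableB.
  by apply: eq_Rintegral => x _; rewrite /f; ring.
rewrite {1}/Rintegral FTC/= => /esym/eqP; rewrite addrC addr_eq0 => /eqP ->.
by ring.
Unshelve. all: by end_near. Qed.

(** Each integration by parts trades a factor [xi / l] for a derivative of one of the two flat
    factors; the induction therefore ranges over all [q] and [r]. *)
Lemma osc_decay k q r : exists2 M : R, 0 < M &
  forall l theta xi, 0 < l -> `|xi / l| ^+ k * `|osc l q r theta xi| <= M / l.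
Proof.
elim: k q r => [|k IH] q r.
  have [M M0 hM] := osc_bound0 q r; exists M => // l theta xi l0.
  by rewrite expr0 mul1r hM.
have [M M0 hM] := IH q (flat_deriv r); have [N N0 hN] := IH (flat_deriv q) r.
exists (M + N); first by rewrite addr_gt0.
(* Starting from the phase [theta - pi / 2] brings the left-hand side back to [theta]. *)
move=> l theta xi l0; have := osc_parts q r (theta - pi / 2) xi l0.
rewrite subrK => E; rewrite exprSr -mulrA -normrM mulrAC E mulrAC divff ?mul1r ?gt_eqF//.
apply: (le_trans (ler_wpM2l (exprn_ge0 _ (normr_ge0 _)) (ler_normB _ _))).
by rewrite mulrDr [leRHS]mulrDl lerD// ?hM ?hN.
Qed.

(** For [l > 0] this is [l / (l ^+ 2 + xi ^+ 2)], the Poisson kernel up to the factor [1 / pi] and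
    the derivative of [atan (xi / l)]; its integral is the same for every such [l]. *)
Definition poisson l xi : R := l^-1 / (1 + (xi / l) ^+ 2).

Lemma poisson_ge0 l xi : 0 < l -> 0 <= poisson l xi.
Proof. by move=> l0; rewrite divr_ge0 ?addr_ge0 ?sqr_ge0// invr_ge0 ltW. Qed.

(* Interpolates the decay exponents 0 and 4, so that [enorm xi ^+ 2] remains
   integrable against the bound. *)
Lemma osc_poisson q r : exists2 M : R, 0 < M &
  forall l theta xi, 0 < l ->
    `|osc l q r theta xi| <= M * (poisson l xi / (1 + (xi / l) ^+ 2)).
Proof.
have [M M0 hM] := osc_decay 0 q r; have [N N0 hN] := osc_decay 4 q r.
exists (2 * (M + N)); first by rewrite mulr_gt0// addr_gt0.
move=> l theta xi l0; rewrite /poisson; have := hM l theta xi l0; have := hN l theta xi l0; rewrite expr0 mul1r.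
set o := `|osc _ _ _ _ _|; set z := xi / l.
have -> : `|z| ^+ 4 = z ^+ 4 by rewrite -normrX ger0_norm// exprn_even_ge0.
move=> h4 h0; have z0 : 0 < 1 + z ^+ 2 by rewrite ltr_pwDl// sqr_ge0.
have -> : 2 * (M + N) * (l^-1 / (1 + z ^+ 2) / (1 + z ^+ 2)) =
    2 * (M / l + N / l) / ((1 + z ^+ 2) * (1 + z ^+ 2)).
  by field; rewrite !gt_eqF.
rewrite ler_pdivlMr ?mulr_gt0//.
have o0 : 0 <= o by exact: normr_ge0.
have : o * ((1 + z ^+ 2) * (1 + z ^+ 2)) <= o * (2 * (1 + z ^+ 4)).
  rewrite ler_wpM2l// -subr_ge0.
  by rewrite (_ : _ - _ = (1 - z ^+ 2) ^+ 2) ?sqr_ge0//; ring.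
by move=> h; apply: (le_trans h); lra.
Qed.

Lemma continuous_poisson l : continuous (poisson l).
Proof.
move=> x; apply: cvgM; first exact: cvg_cst.
apply: cvgV; first by rewrite gt_eqF// ltr_pwDl// sqr_ge0.
apply: cvgD; first exact: cvg_cst.
by rewrite expr2; apply: cvgM; apply: cvgM; by [exact: cvg_id|exact: cvg_cst].
Qed.

Lemma integral_poisson l : 0 < l -> (\int[leb]_x (poisson l x)%:E = pi%:E)%E.
Proof.
move=> l0.
have ca : continuous (fun x : R => x / l).
  by move=> x; apply: cvgM; [exact: cvg_id|exact: cvg_cst].
have cp := @continuous_poisson l.
have da x : is_derive x 1 (fun x => atan (x / l)) (poisson l x).
  have d1 : is_derive x 1 (fun y : R => y / l) l^-1.
    have := is_deriveZ l^-1 (is_derive_id x 1).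
    rewrite /GRing.scale/= mulr1; apply: near_eq_is_derive.
    by near=> y; rewrite mulrC.
  apply: (is_derive_eq (@is_derive1_comp _ atan _ _ _ _ (is_derive1_atan _) d1)).
  by rewrite mulrC.
rewrite ge0_symfun_integralT//; first last.
- by move=> x; rewrite /poisson /= mulNr sqrrN.
- by move=> x; exact: poisson_ge0.
rewrite -set_itvcy (@ge0_continuous_FTC2y _ _ (fun x => atan (x / l)) 0 (pi / 2)).
- by rewrite mul0r atan0 sube0 -EFinM; congr EFin; lra.
- by move=> x _; exact: poisson_ge0.
- exact: continuous_subspaceT.
- have ly : (x / l) @[x --> +oo] --> +oo by apply: gt0_cvgMly => //; rewrite invr_gt0.
  by apply: (@cvg_comp _ _ _ (fun x : R => x / l) (@atan R)); [exact: ly|exact: cvgy_atan].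
- by move=> x _; exact: ex_derive.
- by apply: cvg_at_right_filter; exact: (continuous_compT ca (@continuous_atan R)).
- by move=> x _; rewrite derive1E; exact: derive_val.
Unshelve. all: by end_near. Qed.

End oscillatory_line.

(** * Fourier integrals of bumps in several variables *)

Section oscillatory_space.
Context {R : realType}.
Implicit Type l : R.

Definition osc_rV d l theta (xi : 'rV[R]_d) : R :=
  \int[lebesgue_rV d]_x (cos (dot x xi + theta) * flat_bump l 0 x).

Lemma measurable_dot d (xi : 'rV[R]_d) : measurable_fun setT (fun x => dot x xi).
Proof.
apply: measurable_sum => i; apply: measurable_funM; first exact: measurable_coord.
exact: measurable_cst.
Qed.

Lemma measurable_continuous_rV d (f : 'rV[R]_d -> R) :
  continuous f -> measurable_fun setT f.
Proof.
move=> cf; apply: (measurability _ (RGenOpens.measurableE R)).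
move=> _ [_ [a [b ->]] <-]; rewrite setTI; apply: open_measurable_rV.
by apply: open_comp; [move=> x _; exact: cf|exact: interval_open].
Qed.

Lemma flat_bump_out d l (c x : 'rV[R]_d) : 0 < l -> l^-1 <= `|x - c| -> flat_bump l c x = 0.
Proof.
move=> l0 h; apply/eqP; rewrite eq_le flat_bump_ge0 andbT leNgt flat_bump_gt0//.
by rewrite -leNgt.
Qed.

Lemma measurable_flat_bump d l (c : 'rV[R]_d) : measurable_fun setT (flat_bump l c).
Proof. exact: measurable_continuous_rV (continuous_flat_alg (flat_bump_flat_alg l c)). Qed.

Lemma bounded_support_integrable d (f : 'rV[R]_d -> R) (r : R) :
  measurable_fun setT f -> (forall x, `|f x| <= 1) ->
  (forall x, r <= `|x| -> f x = 0) ->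
  (lebesgue_rV d).-integrable setT (EFin \o f).
Proof.
move=> mf f1 fr; have [n rn] : exists n : nat, r <= n%:R.
  by exists (Num.bound `|r|); rewrite (le_trans (ler_norm r))// ltW// archi_boundP.
apply/integrableP; split; first exact/measurable_EFinP.
have le1 : (\int[lebesgue_rV d]_x `|(EFin \o f) x| <=
    \int[lebesgue_rV d]_x (\1_(@rV_box R d n%:R) x)%:E)%E.
  apply: nonneg_integral_mono => x _; first exact: abse_ge0.
  rewrite /= lee_fin indicE; case: (boolP (x \in _)) => [_|]; first exact: f1.
  move/negP; rewrite inE => h; rewrite fr ?normr0//.
  rewrite leNgt; apply/negP => xr; apply: h => i.
  have := le_lt_trans (rV_norm_coord x i) (lt_le_trans xr rn).
  by rewrite ltr_norml => /andP[-> /ltW ->].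
apply: (le_lt_trans le1); rewrite integral_indic//; last exact: measurable_rV_box.
by rewrite setIT lebesgue_rV_box_lty.
Qed.

Lemma osc_rV_integrable d l theta (xi : 'rV[R]_d) : 0 < l ->
  (lebesgue_rV d).-integrable setT
    (EFin \o (fun x => cos (dot x xi + theta) * flat_bump l 0 x)).
Proof.
move=> l0; apply: (@bounded_support_integrable _ _ l^-1).
- apply: measurable_funM; last exact: measurable_flat_bump.
  apply: measurableT_comp; first exact: continuous_measurable_fun (@continuous_cos R).
  by apply: measurable_funD; [exact: measurable_dot|exact: measurable_cst].
- move=> x; rewrite normrM -[leRHS]mulr1 ler_pM// ?cos_max//.
  by rewrite ger0_norm ?flat_bump_ge0// flat_bump_le1.
- by move=> x h; rewrite flat_bump_out ?subr0// mulr0.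
Qed.

Lemma rcons_rV_lift d (x : 'rV[R]_d) y i : rcons_rV (x, y) ord0 (lift ord_max i) = x ord0 i.
Proof. by rewrite mxE liftK. Qed.

Lemma rcons_rV_max d (x : 'rV[R]_d) y : rcons_rV (x, y) ord0 ord_max = y.
Proof. by rewrite mxE unlift_none. Qed.

Lemma widen_ord_lift d (i : 'I_d) : widen_ord (leqnSn d) i = lift ord_max i.
Proof. by apply: val_inj; rewrite /= /bump leqNgt ltn_ord. Qed.

(** The addition formula for the cosine, with both sines written as cosines shifted by [- (pi / 2)]:
    the family of integrals with a phase is thus stable under removing a coordinate. *)
Lemma osc_rVS d l theta (xi : 'rV[R]_d.+1) : 0 < l ->
  let xi' := \row_i xi ord0 (lift ord_max i) in let t := xi ord0 ord_max in
  osc_rV l theta xi = osc_rV l theta xi' * osc l 1 1 0 t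
    - osc_rV l (theta - pi / 2) xi' * osc l 1 1 (- (pi / 2)) t.
Proof.
move=> l0 xi' t; apply: Rintegral_lebesgue_rVS.
- apply: measurable_funM; last exact: measurable_flat_bump.
  apply: measurableT_comp; first exact: continuous_measurable_fun (@continuous_cos R).
  by apply: measurable_funD; [exact: measurable_dot|exact: measurable_cst].
- move=> x y; rewrite /dot /flat_bump !big_ord_recr/=.
  under eq_bigr do rewrite widen_ord_lift rcons_rV_lift.
  under [X in _ * (X * _)]eq_bigr do rewrite widen_ord_lift rcons_rV_lift [in X in X * _]mxE [in X in _ * X]mxE.
  rewrite rcons_rV_max mxE subr0 -/t.
  have -> : \sum_(i < d) x ord0 i * xi' ord0 i = \sum_(i < d) x ord0 i * xi ord0 (lift ord_max i).
    by apply: eq_bigr => i _; rewrite mxE.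
  have -> : \prod_(i < d) (flat 1 (1 + l * (x ord0 i - (0 : 'rV[R]_d) ord0 i)) *
       flat 1 (1 - l * (x ord0 i - (0 : 'rV[R]_d) ord0 i))) =
      \prod_(i < d) (flat 1 (1 + l * (x ord0 i - 0)) * flat 1 (1 - l * (x ord0 i - 0))).
    by apply: eq_bigr => i _; rewrite mxE.
  rewrite -/(wave l 1 1 y).
  set a := \sum_(i < d) _; set b := \prod_(i < d) _.
  rewrite (_ : a + y * t + theta = (a + theta) + y * t); last by ring.
  have C (u v : R) : cos (u + v) = cos u * cos v - cos (u - pi / 2) * cos (v - pi / 2).
    by rewrite cosD !cosBpihalf.
  by rewrite (C (a + theta)) addr0 (addrA a theta (- _)); ring.
- exact: osc_rV_integrable.
- exact: osc_rV_integrable.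
- exact: osc_integrable.
- exact: osc_integrable.
Qed.

End oscillatory_space.

Lemma osc_rV_poisson (R : realType) (d : nat) : exists2 C : R, 0 < C &
  forall l theta (xi : 'rV[R]_d), 0 < l ->
  `|osc_rV l theta xi| <= C * \prod_i (poisson l (xi ord0 i) / (1 + (xi ord0 i / l) ^+ 2)).
Proof.
have [M M0 hM] := osc_poisson (1 : {poly R}) 1.
(* Each coordinate contributes [M] for its line integral and 2 for the two terms of the addition
   formula. *)
exists ((2 * M) ^+ d); first by rewrite exprn_gt0// mulr_gt0.
move=> l theta xi l0; elim: d theta xi => [|d IH] theta xi.
  rewrite big_ord0 expr0 mulr1 /osc_rV.
  apply: (@Rintegral_abs_le _ _ _ _ _ _ (fun=> 1)) => [x _|].
    rewrite normrM -[leRHS]mulr1 ler_pM// ?cos_max//.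
    by rewrite ger0_norm ?flat_bump_ge0// flat_bump_le1.
  by rewrite integral_cst//= diracT mule1.
rewrite osc_rVS//= (le_trans (ler_normB _ _))// !normrM.
have P0 y : 0 <= poisson l y / (1 + (y / l) ^+ 2).
  by rewrite divr_ge0 ?poisson_ge0 ?addr_ge0 ?sqr_ge0.
rewrite big_ord_recr/= exprSr.
under eq_bigr do rewrite widen_ord_lift.
set p := \prod_(i < d) _; set t := xi ord0 ord_max; set xi' := \row_i _.
have E th : `|osc_rV l th xi'| <= (2 * M) ^+ d * p.
  rewrite (le_trans (IH _ _))// /p; under eq_bigr do rewrite mxE.
  exact: lexx.
have B th th' : `|osc_rV l th xi'| * `|osc l 1 1 th' t| <=
    ((2 * M) ^+ d * p) * (M * (poisson l t / (1 + (t / l) ^+ 2))).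
  by rewrite ler_pM// ?E ?hM.
by apply: (le_trans (lerD (B _ _) (B _ _))); rewrite le_eqVlt; apply/orP; left; apply/eqP; ring.
Qed.

Lemma measurable_poisson (R : realType) d (l : R) :
  measurable_fun setT (fun xi : 'rV[R]_d => \prod_i poisson l (xi ord0 i)).
Proof.
apply: measurable_prod => i _; apply: (measurableT_comp _ (measurable_coord i)).
exact: continuous_measurable_fun (@continuous_poisson R l).
Qed.

Lemma integral_poisson_rV (R : realType) d (l : R) : 0 < l ->
  (\int[lebesgue_rV d]_xi (\prod_i poisson l (xi ord0 i))%:E = (pi ^+ d)%:E)%E.
Proof.
move=> l0; elim: d => [|d IH].
  rewrite integral_dirac//.
    by rewrite diracT mul1e big_ord0 expr0.
  by apply/measurable_EFinP; exact: measurable_poisson.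
have p0 n (xi : 'rV[R]_n) : 0 <= \prod_i poisson l (xi ord0 i).
  by apply: prodr_ge0 => i _; exact: poisson_ge0.
rewrite ge0_integral_lebesgue_rVS//; first last.
- by move=> x; rewrite lee_fin p0.
- by apply/measurable_EFinP; exact: measurable_poisson.
under eq_integral => x _.
  under eq_integral => y _.
    rewrite big_ord_recr/= rcons_rV_max.
    under eq_bigr do rewrite widen_ord_lift rcons_rV_lift.
    rewrite EFinM.
    over.
  rewrite ge0_integralZl//=; first last.
  - by rewrite lee_fin p0.
  - by move=> y _; rewrite lee_fin poisson_ge0.
  - by apply/measurable_EFinP; exact: continuous_measurable_fun (@continuous_poisson R l).
  rewrite integral_poisson//.
  over.
rewrite ge0_integralZr//=; first last.
- by rewrite lee_fin pi_ge0.
- by move=> y _; rewrite lee_fin p0.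
- by apply/measurable_EFinP; exact: measurable_poisson.
by rewrite IH -EFinM exprSr.
Qed.

(** * Symbols *)

Section symbol_estimates.
Local Open Scope complex_scope.
Context {R : realType}.

Lemma mean_value_bound (f df : R -> R) (M x : R) :
  (forall y : R, is_derive y (1 : R) f (df y)) -> (forall y : R, `|y| <= `|x| -> `|df y| <= M) ->
  `|f x - f 0| <= M * `|x|.
Proof.
move=> dF dM; have cf a b : {within `[a, b], continuous f}.
  apply: continuous_subspaceT => y.
  by apply/differentiable_continuous/derivable1_diffP; exact: ex_derive.
have [x0|x0] := leP 0 x.
  have [c + ->] := @MVT_segment R f df 0 x x0 (fun y _ => dF y) (cf 0 x).
  rewrite in_itv/= subr0 normrM => /andP[c0 cx].
  by rewrite ler_wpM2r// dM// !ger0_norm.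
have [c + E] := @MVT_segment R f df x 0 (ltW x0) (fun y _ => dF y) (cf x 0).
rewrite in_itv/= => /andP[cx c0].
rewrite distrC E sub0r normrM normrN ler_wpM2r// dM//.
by rewrite !ler0_norm ?lerN2// ltW.
Qed.

Lemma sin_abs_le (x : R) : `|sin x| <= `|x|.
Proof.
rewrite -[sin x]subr0 -sin0 -[leRHS]mul1r.
apply: (@mean_value_bound sin cos) => y _; exact: cos_max.
Qed.

Lemma cos_sub1_le (x : R) : `|1 - cos x| <= `|x|.
Proof.
rewrite distrC -cos0 -[leRHS]mul1r.
by apply: (@mean_value_bound cos (fun y => - sin y)) => y _; rewrite normrN sin_max.
Qed.

Lemma cos_sub1_le_sqr (x : R) : `|1 - cos x| <= x ^+ 2.
Proof.
rewrite distrC -cos0 -real_normK ?num_real// expr2.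
apply: (@mean_value_bound cos (fun y => - sin y)) => y yx.
by rewrite normrN (le_trans (sin_abs_le y)).
Qed.

Lemma sub_sin_le_sqr (x : R) : `|x - sin x| <= x ^+ 2.
Proof.
have := @mean_value_bound (fun y => y - sin y) (fun y => 1 - cos y) `|x| x.
rewrite sin0 subr0 subr0 -expr2 real_normK ?num_real//; apply.
by move=> y yx; rewrite (le_trans (cos_sub1_le y)).
Qed.

Context {d : nat}.
Implicit Types (x y z xi : 'rV[R]_d).

Lemma dot_ge0 x : 0 <= dot x x.
Proof. by apply: sumr_ge0 => i _; rewrite -expr2 sqr_ge0. Qed.

Lemma enorm_ge0 x : 0 <= enorm x. Proof. exact: sqrtr_ge0. Qed.

Lemma enorm_sqr x : enorm x ^+ 2 = \sum_i x ord0 i ^+ 2.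
Proof. by rewrite sqr_sqrtr ?dot_ge0//; apply: eq_bigr => i _; rewrite expr2. Qed.

Lemma coord_le_enorm x i : `|x ord0 i| <= enorm x.
Proof.
rewrite -(@ler_pXn2r _ 2) ?nnegrE ?enorm_ge0// enorm_sqr real_normK ?num_real//.
by rewrite (bigD1 i)//= lerDl sumr_ge0// => j _; rewrite sqr_ge0.
Qed.

Lemma dot_le_enorm_sum x y : `|dot x y| <= enorm x * \sum_i `|y ord0 i|.
Proof.
rewrite mulr_sumr (le_trans (ler_norm_sum _ _ _))// ler_sum// => i _.
by rewrite normrM ler_wpM2r// coord_le_enorm.
Qed.

Lemma dot_le_enorm x y : `|dot x y| <= d%:R * (enorm x * enorm y).
Proof.
rewrite (le_trans (dot_le_enorm_sum _ _))// mulrCA ler_wpM2l ?enorm_ge0//.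
rewrite (le_trans (ler_sum _ (fun i _ => coord_le_enorm y i)))//.
by rewrite sumr_const card_ord mulr_natl.
Qed.

Lemma cabs_le (z : R[i]) : cabs z <= `|complex.Re z| + `|complex.Im z|.
Proof.
case: z => a b /=; rewrite /cabs/= -(@ler_pXn2r _ 2) ?nnegrE ?sqrtr_ge0 ?addr_ge0//.
rewrite sqr_sqrtr ?addr_ge0 ?sqr_ge0// sqrrD !real_normK ?num_real//.
by rewrite lerD2r lerDl mulrn_wge0// mulr_ge0.
Qed.

Lemma Re_le_cabs (z : R[i]) : `|complex.Re z| <= cabs z.
Proof.
case: z => a b /=; rewrite /cabs/= -sqrtr_sqr ler_sqrt ?addr_ge0 ?sqr_ge0//.
by rewrite lerDl sqr_ge0.
Qed.

Lemma cabsM (z w : R[i]) : cabs (z * w) = cabs z * cabs w.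
Proof. exact: ComplexField.Normc.normcM. Qed.

Lemma cabs_ge0 (z : R[i]) : 0 <= cabs z.
Proof. by case: z => ? ?; exact: sqrtr_ge0. Qed.

Lemma cabs_expi (r : R) : cabs (expi r) = 1.
Proof. by rewrite /cabs/= cos2Dsin2 sqrtr1. Qed.

Lemma measurable_enorm : measurable_fun setT (@enorm R d).
Proof.
apply: (@measurableT_comp _ _ _ _ _ _ (fun x : R => Num.sqrt x)).
  exact: continuous_measurable_fun (@sqrt_continuous R).
by apply: measurable_sum => i; apply: measurable_funM; exact: measurable_coord.
Qed.

(** * Levy-Khinchine exponents near the origin *)

Section levy.
Variables (a : 'M[R]_d) (b : 'rV[R]_d) (nu : {measure set 'rV[R]_d -> \bar R}).
Hypothesis nuL : levy_measure nu.

Local Notation D := ([set~ (0 : 'rV[R]_d)]).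

Let measurableD0 : measurable D.
Proof.
apply: measurableC.
rewrite (_ : [set 0] = \bigcap_(i in [set: 'I_d])
    ((fun x : 'rV[R]_d => x ord0 i) @^-1` [set 0])).
  apply: fin_bigcap_measurable => // i _.
  by rewrite -[X in measurable X]setTI; apply: measurable_coord.
apply/seteqP; split => [x -> i _ /=|x h]; first by rewrite mxE.
by apply/rowP => i; rewrite mxE; exact: (h i I).
Qed.

(** The summands serve the three bounds on the integrand: [d ^+ 2] the quadratic one for small
    jumps, [d] the linear one and 2 the trivial one for large jumps. The powers of [d] come from the
    crude Cauchy-Schwarz inequality [dot_le_enorm]. *)
Let K : R := d%:R ^+ 2 + d%:R + 2.

Let K0 : 0 < K. Proof. by rewrite /K ltr_wpDl// addr_ge0// sqr_ge0. Qed.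

(** The first factor is integrable against a Levy measure; the second stays below [K] and vanishes
    with [e] for each [z]. The truncation at [K] is essential, since large jumps may have infinite
    mean. *)
Let G (e : R) z : R :=
  Num.min 1 (enorm z ^+ 2) * Num.min K (K * ((enorm z + 1) * e)).

(** These are the real and imaginary parts of the jump integrand. The compensator acts only for
    [enorm z <= 1], where it cancels the linear term of the sine and leaves a quadratic bound. *)
Let jump_bounds (e : R) z xi : 0 <= e <= 1 -> enorm xi <= e ->
  `|1 - cos (dot z xi)| <= G e z /\
  `|dot z xi * (enorm z <= 1)%R%:R - sin (dot z xi)| <= G e z.
Proof.
move=> /andP[e0 e1] xe; have z0 := enorm_ge0 z.
have d0 : 0 <= d%:R :> R by [].
have hd : `|dot z xi| <= d%:R * (enorm z * e).
  by rewrite (le_trans (dot_le_enorm _ _))// ler_wpM2l// ler_wpM2l.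
have dz : 0 <= enorm z * e by rewrite mulr_ge0.
rewrite /G; have [z1|z1] := leP (enorm z) 1.
  have -> : Num.min 1 (enorm z ^+ 2) = enorm z ^+ 2.
    by apply/min_idPr; rewrite expr_le1.
  rewrite mulr1.
  suff H : dot z xi ^+ 2 <= enorm z ^+ 2 * Num.min K (K * ((enorm z + 1) * e)).
    split; first exact: le_trans (cos_sub1_le_sqr _) H.
    exact: le_trans (sub_sin_le_sqr _) H.
  have sq : dot z xi ^+ 2 <= enorm z ^+ 2 * (d%:R ^+ 2 * e ^+ 2).
    rewrite -real_normK ?num_real// (_ : _ * _ = (d%:R * (enorm z * e)) ^+ 2); last by ring.
    by rewrite ler_pXn2r ?nnegrE// mulr_ge0.
  apply: (le_trans sq); rewrite ler_wpM2l ?sqr_ge0// le_min.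
  have dK : d%:R ^+ 2 <= K by rewrite /K; lra.
  have ee : e ^+ 2 <= e by rewrite expr2 ler_piMl.
  have d2 : 0 <= d%:R ^+ 2 :> R by exact: sqr_ge0.
  apply/andP; split.
    by rewrite (le_trans _ dK)// ler_piMr// expr_le1.
  rewrite ler_pM ?sqr_ge0// (le_trans ee)// ler_peMl//; lra.
have -> : Num.min 1 (enorm z ^+ 2) = 1.
  by apply/min_idPl; rewrite expr_ge1// ltW.
rewrite mulr0 sub0r normrN mul1r.
have hK : d%:R * (enorm z * e) <= K * ((enorm z + 1) * e).
  rewrite ler_pM//; first by rewrite /K; have := sqr_ge0 (d%:R : R); lra.
  by rewrite ler_wpM2r//; lra.
have K2 : 2 <= K by rewrite /K; have := sqr_ge0 (d%:R : R); lra.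
rewrite !le_min; split; apply/andP; split.
- rewrite (le_trans (ler_normB _ _))// (le_trans _ K2)// normr1.
  by have := cos_max (dot z xi); lra.
- by rewrite (le_trans (cos_sub1_le _))// (le_trans hd).
- by rewrite (le_trans (sin_max _))//; lra.
- by rewrite (le_trans (sin_abs_le _))// (le_trans hd).
Qed.

Let min_ge0 z : 0 <= Num.min 1 (enorm z ^+ 2).
Proof. by rewrite le_min ler01 sqr_ge0. Qed.

Let min_measurable : measurable_fun D (fun z => Num.min 1 (enorm z ^+ 2)).
Proof.
apply: measurable_minr; first exact: measurable_cst.
by apply: measurable_funX; exact: measurable_funTS measurable_enorm.
Qed.

Let min_integrable : nu.-integrable D (EFin \o (fun z => K * Num.min 1 (enorm z ^+ 2))).
Proof.
apply: RintegrableZl => //; apply/integrableP; split; first exact/measurable_EFinP.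
move: nuL => [_]; apply: le_lt_trans; apply: nonneg_integral_mono => z _ /=.
  by rewrite lee_fin.
by rewrite lee_fin ger0_norm.
Qed.

Let G_measurable n : measurable_fun D (G n.+1%:R^-1).
Proof.
apply: measurable_funM => //.
apply: measurable_minr; first exact: measurable_cst.
apply: measurable_funM; first exact: measurable_cst.
apply: measurable_funM; last exact: measurable_cst.
apply: measurable_funD; last exact: measurable_cst.
exact: measurable_funTS measurable_enorm.
Qed.

Let G_bound n z : `|G n.+1%:R^-1 z| <= K * Num.min 1 (enorm z ^+ 2).
Proof.
rewrite /G ger0_norm; first by rewrite mulrC ler_wpM2r// ge_min lexx.
rewrite mulr_ge0// le_min (ltW K0)/= mulr_ge0 ?(ltW K0)// mulr_ge0//.
by rewrite addr_ge0// enorm_ge0.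
Qed.

Let G_integrable n : nu.-integrable D (EFin \o G n.+1%:R^-1).
Proof.
apply: le_integrable min_integrable => //; first exact/measurable_EFinP.
move=> z _; rewrite /= lee_fin (le_trans (G_bound n z))//.
exact: ler_norm.
Qed.

Let G_cvg0 : \int[nu]_(z in D) G n.+1%:R^-1 z @[n --> \oo] --> (0 : R).
Proof.
have E0 : \int[nu]_(z in D) (cst (0 : R) z) = 0 by rewrite /Rintegral integral0_eq.
rewrite -[X in _ --> X]E0.
apply: (Rdominated_cvg _ _ _ min_integrable) => //.
move=> z _; apply: (@squeeze_cvgr _ _ _ _ (cst 0)
    (fun n => Num.min 1 (enorm z ^+ 2) * (K * (enorm z + 1)) * n.+1%:R^-1)).
- near=> n; rewrite /G -mulrA ler_wpM2l ?andbT//; last by rewrite ge_min -mulrA lexx orbT.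
  by rewrite mulr_ge0// le_min (ltW K0)/= mulr_ge0 ?(ltW K0)// mulr_ge0// addr_ge0// enorm_ge0.
- exact: cvg_cst.
- rewrite -[X in _ --> X](mulr0 (Num.min 1 (enorm z ^+ 2) * (K * (enorm z + 1)))).
  by apply: cvgM; [exact: cvg_cst|exact: cvg_harmonic].
Unshelve. all: by end_near. Qed.

Let quadratic_bound : exists2 A : R, 0 <= A & forall xi, enorm xi <= 1 ->
  `|2^-1 * dot xi (xi *m a)| + `|dot b xi| <= A * enorm xi.
Proof.
exists (\sum_j \sum_i `|a i j| + \sum_i `|b ord0 i|).
  by rewrite addr_ge0 ?sumr_ge0// => i _; rewrite sumr_ge0.
move=> xi x1; have x0 := enorm_ge0 xi; rewrite mulrDl lerD//.
  rewrite normrM gtr0_norm ?invr_gt0// (@le_trans _ _ (1 * `|dot xi (xi *m a)|))//.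
    by rewrite ler_wpM2r// invf_le1// ler1n.
  rewrite mul1r (le_trans (dot_le_enorm_sum _ _))// mulrC ler_wpM2r// ler_sum// => j _.
  rewrite mxE (le_trans (ler_norm_sum _ _ _))// ler_sum// => i _.
  rewrite normrM ler_piMl// (le_trans (coord_le_enorm _ _))//.
have -> : dot b xi = dot xi b by apply: eq_bigr => i _; rewrite mulrC.
by rewrite (le_trans (dot_le_enorm_sum _ _))// mulrC.
Qed.

Let ReD (z w : R[i]) : complex.Re (z + w) = complex.Re z + complex.Re w.
Proof. by case: z; case: w. Qed.

Let ImD (z w : R[i]) : complex.Im (z + w) = complex.Im z + complex.Im w.
Proof. by case: z; case: w. Qed.

(** Dominated convergence makes the jump part small, while the drift and diffusion parts are at most
    linear in [enorm xi] on the unit ball. *)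
Lemma levy_khinchine_small (e : R) : 0 < e -> exists2 r : R, 0 < r &
  forall xi, enorm xi <= r -> cabs (levy_khinchine a b nu xi) <= e.
Proof.
move=> e0; have [A A0 hA] := quadratic_bound.
have e4 : 0 < e / 4 by rewrite divr_gt0.
have [n hn] : exists n, \int[nu]_(z in D) G n.+1%:R^-1 z <= e / 4.
  have /cvgrPdist_le/(_ _ e4)[n _ hn] := G_cvg0.
  by exists n; have := hn n (leqnn n); rewrite sub0r normrN; apply: le_trans; exact: ler_norm.
(* The first bound leaves [e / 4] for each of the real and imaginary jump integrals, the second
   leaves [e / 2] for drift and diffusion together; [A + 1] guards against [A = 0]. *)
pose r := Num.min n.+1%:R^-1 (e / 2 / (A + 1)).
have A1 : 0 < A + 1 by rewrite ltr_wpDl.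
exists r; first by rewrite lt_min invr_gt0 ltr0Sn !divr_gt0.
move=> xi; rewrite le_min => /andP[xn xA].
have n1 : n.+1%:R^-1 <= 1 :> R by rewrite invf_le1// ler1n.
have x1 : enorm xi <= 1 by exact: le_trans n1.
have GE : (\int[nu]_(z in D) (G n.+1%:R^-1 z)%:E <= (e / 4)%:E)%E.
  by rewrite -(fineK (integrable_fin_num _ (G_integrable n)))// lee_fin.
have n01 : 0 <= (n.+1%:R^-1 : R) <= 1 by rewrite invr_ge0 ler0n.
rewrite (le_trans (cabs_le _))// /levy_khinchine !ReD !ImD.
set ci := cintegral _ _ _.
have cR : `|complex.Re ci| <= e / 4.
  apply: Rintegral_abs_le GE => z _.
  by rewrite !ReD/= ?oppr0 ?addr0; have [] := jump_bounds z n01 xn.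
have cI : `|complex.Im ci| <= e / 4.
  apply: Rintegral_abs_le GE => z _.
  by rewrite !ImD/= ?add0r addrC; have [] := jump_bounds z n01 xn.
have := hA _ x1.
have : A * enorm xi <= e / 2.
  rewrite (@le_trans _ _ ((A + 1) * enorm xi))//.
    by rewrite ler_wpM2r ?enorm_ge0// lerDl.
  by rewrite mulrC -ler_pdivlMr.
rewrite /= ?oppr0 ?addr0 ?add0r.
set u := `|_ * dot _ _|; set v := `|dot b xi| => h1 h2.
rewrite (le_trans (lerD (ler_normD _ _) (ler_normD _ _)))//.
by rewrite normrN -/u -/v; lra.
Qed.

End levy.

(** Converts the coordinatewise decay factors [1 + (xi_i / l) ^+ 2] into the Euclidean factor
    [1 + enorm xi ^+ 2 / l ^+ 2]. *)
Lemma ler_1D_sum_prod (F : 'I_d -> R) : (forall i, 0 <= F i) ->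
  1 + \sum_i F i <= \prod_i (1 + F i).
Proof.
(* The sign of the partial sums is carried along because the cross term of [(1 + s1) * (1 + s2)] has
   to be nonnegative. *)
move=> F0; suff [] : 0 <= \sum_i F i /\ 1 + \sum_i F i <= \prod_i (1 + F i) by [].
elim/big_ind2 : _ => [|s1 p1 s2 p2 [h1 k1] [h2 k2]|i _]; first by rewrite addr0.
  split; first exact: addr_ge0.
  by rewrite (@le_trans _ _ ((1 + s1) * (1 + s2)))//; [nra|rewrite ler_pM// addr_ge0].
by split.
Qed.

Lemma fourier_flat_bump l xi : cabs (fourier (flat_bump l 0) xi) <=
  (2 * pi) ^- d * (`|osc_rV l 0 xi| + `|osc_rV l (pi / 2) xi|).
Proof.
have p0 : 0 <= (2 * pi : R) ^- d by rewrite invr_ge0 exprn_ge0// mulr_ge0// pi_ge0.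
rewrite /fourier cabsM.
have -> : cabs ((2 * pi : R) ^- d)%:C = (2 * pi) ^- d.
  by rewrite /cabs/= expr0n/= addr0 sqrtr_sqr ger0_norm.
rewrite ler_wpM2l// (le_trans (cabs_le _))// /cintegral/=.
rewrite lerD// le_eqVlt; apply/orP; left; apply/eqP; congr (`| _ |).
  by apply: eq_Rintegral => x _; rewrite /= mulr0 subr0 addr0 cosN.
by apply: eq_Rintegral => x _; rewrite /= mulr0 add0r sinN cosDpihalf.
Qed.

(** The Fourier transform is bounded by a product of Poisson kernels divided by
    [q = 1 + enorm xi ^+ 2 / l ^+ 2], and [(e + C * enorm xi ^+ 2) / q] is at most [e + C * l ^+ 2].
    What remains integrates to [pi ^+ d], so [K] depends on the dimension alone. *)
Lemma pdo_flat_bump_bound : exists2 K : R, 0 < K &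
  forall (p : 'rV[R]_d -> 'rV[R]_d -> R[i]) x (e C l : R),
    0 < l -> 0 <= e -> 0 <= C ->
    (forall xi, cabs (p x xi) <= e + C * enorm xi ^+ 2) ->
    `|complex.Re (pdo p (flat_bump l 0) x)| <= K * (e + C * l ^+ 2).
Proof.
have [M M0 hM] := osc_rV_poisson R d.
have pi20 : 0 < (2 * pi : R) ^- d by rewrite invr_gt0 exprn_gt0// mulr_gt0// pi_gt0.
exists ((2 * pi) ^- d * (2 * M) * pi ^+ d).
  by rewrite !mulr_gt0// exprn_gt0// pi_gt0.
move=> p x e C l l0 e0 C0 hp.
pose c := (2 * pi) ^- d * (2 * M) * (e + C * l ^+ 2).
have c0 : 0 <= c.
  by rewrite !mulr_ge0// ?(ltW M0) ?(ltW pi20)// addr_ge0// mulr_ge0// sqr_ge0.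
apply: (@Rintegral_abs_le _ _ _ _ _ _
    (fun xi => c * \prod_i poisson l (xi ord0 i))) => [xi _|]; last first.
  under eq_integral do rewrite EFinM.
  rewrite ge0_integralZl//=; first last.
  - by move=> xi _; rewrite lee_fin; apply: prodr_ge0 => i _; exact: poisson_ge0.
  - by apply/measurable_EFinP; exact: measurable_poisson.
  by rewrite integral_poisson_rV// -EFinM lee_fin le_eqVlt; apply/orP; left; apply/eqP;
    rewrite /c; ring.
rewrite (le_trans (Re_le_cabs _))// cabsM (cabsM (expi _)) cabs_expi mul1r.
set pp := \prod_i poisson l (xi ord0 i).
have pp0 : 0 <= pp by apply: prodr_ge0 => i _; exact: poisson_ge0.
set q := 1 + enorm xi ^+ 2 / l ^+ 2.
have q0 : 0 < q by rewrite ltr_pwDl// divr_ge0// sqr_ge0.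
have osc_q th : `|osc_rV l th xi| <= M * (pp / q).
  rewrite (le_trans (hM l th xi l0))// ler_wpM2l ?(ltW M0)//.
  rewrite big_split/= ler_wpM2l// prodfV lef_pV2 ?posrE//; last first.
    by apply: prodr_gt0 => i _; rewrite ltr_pwDl// sqr_ge0.
  rewrite /q enorm_sqr mulr_suml.
  rewrite (eq_bigr (fun i => (xi ord0 i / l) ^+ 2)); last by move=> i _; rewrite expr_div_n.
  by apply: ler_1D_sum_prod => i; rewrite sqr_ge0.
rewrite (le_trans (ler_pM _ _ (hp xi) (fourier_flat_bump l xi)))//; try exact: cabs_ge0.
have h1 : (2 * pi) ^- d * (`|osc_rV l 0 xi| + `|osc_rV l (pi / 2) xi|) <=
   (2 * pi) ^- d * (2 * M * (pp / q)).
  rewrite ler_wpM2l ?(ltW pi20)// (_ : 2 * M * _ = M * (pp / q) + M * (pp / q)); last by ring.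
  by rewrite lerD.
have eC : 0 <= e + C * enorm xi ^+ 2 by rewrite addr_ge0// mulr_ge0// sqr_ge0.
rewrite (le_trans (ler_wpM2l eC h1))//.
have -> : (e + C * enorm xi ^+ 2) * ((2 * pi) ^- d * (2 * M * (pp / q))) =
   (2 * pi) ^- d * (2 * M) * ((e + C * enorm xi ^+ 2) / q) * pp by ring.
rewrite ler_wpM2r// /c ler_wpM2l ?mulr_ge0 ?(ltW M0) ?(ltW pi20)//.
rewrite ler_pdivrMr// /q mulrDr mulr1 mulrDl.
have -> : e + C * enorm xi ^+ 2 = e + C * l ^+ 2 * (enorm xi ^+ 2 / l ^+ 2).
  by field; rewrite gt_eqF.
have H1 : 0 <= enorm xi ^+ 2 / l ^+ 2 by rewrite divr_ge0// sqr_ge0.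
have H2 : 0 <= e * (enorm xi ^+ 2 / l ^+ 2) by rewrite mulr_ge0.
have H3 : 0 <= C * l ^+ 2 by rewrite mulr_ge0// sqr_ge0.
lra.
Qed.

(** Within radius [r] the symbol is below [e]; beyond it, [1 <= enorm xi ^+ 2 / r ^+ 2] absorbs the
    constant of the global bound into the quadratic term. [C] depends on [x], which gives
    convergence of [A (u l)] at each point only. *)
Lemma symbol_quadratic_bound (p : 'rV[R]_d -> 'rV[R]_d -> R[i]) (c : R) x :
  0 < c ->
  (exists a b nu, [/\ nonneg_definite a, levy_measure nu & p x = levy_khinchine a b nu]) ->
  (forall xi, cabs (p x xi) <= c * (1 + enorm xi ^+ 2)) ->
  forall e : R, 0 < e -> exists2 C : R, 0 <= C &
    forall xi, cabs (p x xi) <= e + C * enorm xi ^+ 2.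
Proof.
move=> c0 [a [b [nu [_ nuL pE]]]] pc e e0.
have [r r0 hr] := levy_khinchine_small a b nuL e0.
exists (c * (1 + r ^- 2)).
  by rewrite mulr_ge0 ?(ltW c0)// addr_ge0// invr_ge0 sqr_ge0.
move=> xi; have s0 := sqr_ge0 (enorm xi); have [xr|xr] := leP (enorm xi) r.
  rewrite pE (le_trans (hr _ xr))// lerDl mulr_ge0// mulr_ge0 ?(ltW c0)//.
  by rewrite addr_ge0// invr_ge0 sqr_ge0.
rewrite (le_trans (pc xi))// ler_wpDl ?(ltW e0)// -mulrA ler_wpM2l ?(ltW c0)//.
rewrite mulrDl mul1r addrC lerD2l mulrC ler_pdivlMr ?exprn_gt0// mul1r.
by rewrite ler_pXn2r ?nnegrE ?enorm_ge0// ltW.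
Qed.

End symbol_estimates.

(** * Feller semigroups and conservativeness *)

Section local_uniform_limit.
Context {R : realType} {T : topologicalType}.
Implicit Types (f g : T -> R) (x : T).

(** The approximant may depend on the point as well as on [e]: the tail estimates below hold only
    near a given point. *)
Lemma continuous_local_uniform_limit f :
  (forall x (e : R), 0 < e -> exists2 h : T -> R, continuous h & \forall y \near x, `|h y - f y| <= e) ->
  continuous f.
Proof.
move=> fh x; apply/cvgrPdist_le => e e0.
have e3 : 0 < e / 3 by rewrite divr_gt0.
have [h ch hf] := fh x _ e3.
have hx : `|h x - f x| <= e / 3 := nbhs_singleton hf.
have chx := ch x; move/cvgrPdist_le in chx; have {}chx := chx _ e3.
near=> y.
have h1 : `|h x - h y| <= e / 3 by near: y.
have h2 : `|h y - f y| <= e / 3 by near: y.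
rewrite (_ : f x - f y = - (h x - f x) + (h x - h y) + (h y - f y)); last by ring.
rewrite (le_trans (ler_normD _ _))// (_ : e = e / 3 + e / 3 + e / 3); last by field.
by rewrite lerD// (le_trans (ler_normD _ _))// normrN lerD.
Unshelve. all: by end_near. Qed.

Lemma continuous_prod (I : Type) (s : seq I) (F : I -> T -> R) :
  (forall i, continuous (F i)) -> continuous (fun x => \prod_(i <- s) F i x).
Proof.
move=> cF; elim: s => [|i s IH].
  rewrite (_ : (fun x => _) = (fun=> 1)); first exact: cst_continuous.
  by apply/funext => x; rewrite big_nil.
rewrite (_ : (fun x => _) = (fun x => F i x * \prod_(i <- s) F i x)).
  exact: continuous_funM.
by apply/funext => x; rewrite big_cons.
Qed.

Lemma continuous_uniform_limit f :
  (forall e : R, 0 < e -> exists2 h : T -> R, continuous h & forall x, `|h x - f x| <= e) ->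
  continuous f.
Proof.
move=> fh; apply: continuous_local_uniform_limit => x e /fh[h ch hf].
by exists h => //; exact: nearW.
Qed.

End local_uniform_limit.

Lemma dist_max_le (R : realDomainType) (s t : R) :
  `|Num.max s 0 - Num.max t 0| <= `|s - t|.
Proof.
have [s0|s0] := leP 0 s; have [t0|t0] := leP 0 t; rewrite ?subrr ?normr0//.
  by rewrite subr0 ger0_norm// (le_trans _ (ler_norm _))// lerDl oppr_ge0 ltW.
by rewrite sub0r normrN ger0_norm// distrC (le_trans _ (ler_norm _))// lerDl oppr_ge0 ltW.
Qed.

Section continuous_vanishing_functions.
Context {R : realType} {d : nat}.
Implicit Types (u v f g h : 'rV[R]_d -> R) (x y : 'rV[R]_d).

Lemma borel_boundedP u :
  borel_bounded u <-> measurable_fun setT u /\ exists M : R, forall x, `|u x| <= M.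
Proof.
split=> -[mu]; [move=> [M [Mr hM]]|move=> [M hM]]; split => //.
  by exists (M + 1) => x; apply: hM => //; rewrite ltrDl.
exists M; split; first exact: num_real.
by move=> M' MM' x _; apply: (le_trans (hM x)); exact: ltW.
Qed.

Lemma continuous_vanishing_uniform_limit f :
  (forall e : R, 0 < e -> exists2 h, continuous_vanishing h & forall x, `|h x - f x| <= e) ->
  continuous_vanishing f.
Proof.
move=> fh; split.
  by apply: continuous_uniform_limit => e /fh[h [ch _] hf]; exists h.
move=> e e0; have e2 : 0 < e / 2 by rewrite divr_gt0.
have [h [_ /(_ _ e2)[r hr]] hf] := fh _ e2.
exists r => x /hr hx; rewrite (_ : f x = h x - (h x - f x)); last by ring.
by rewrite (le_lt_trans (ler_normB _ _))// [ltRHS]splitr ltr_leD.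
Qed.

Lemma rV_norm_le_enorm x : `|x| <= enorm x.
Proof. by apply: rV_norm_le; [exact: enorm_ge0|move=> i; exact: coord_le_enorm]. Qed.

Lemma enorm_le_rV_norm x : enorm x <= d%:R * `|x|.
Proof.
have h : enorm x ^+ 2 <= enorm x * (d%:R * `|x|).
  rewrite sqr_sqrtr ?dot_ge0// (le_trans (ler_norm _))// (le_trans (dot_le_enorm_sum _ _))//.
  rewrite ler_wpM2l ?enorm_ge0// (le_trans (ler_sum _ (fun i _ => rV_norm_coord x i)))//.
  by rewrite sumr_const card_ord mulr_natl.
have := enorm_ge0 x; rewrite le_eqVlt => /predU1P[<-|x0]; first by rewrite mulr_ge0.
by rewrite -(ler_pM2l x0) -expr2.
Qed.

Lemma compact_rV_ball (r : R) : compact [set x : 'rV[R]_d | `|x| <= r].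
Proof.
apply: bounded_closed_compact.
  exists r; split; first exact: num_real.
  by move=> M rM x /= xr; rewrite (le_trans xr)// ltW.
have -> : [set x : 'rV[R]_d | `|x| <= r] = closed_ball_ Num.norm (0 : 'rV[R]_d) r.
  by apply/seteqP; split => x; rewrite /closed_ball_/= sub0r normrN.
exact: closed_closed_ball_.
Qed.

Lemma continuous_vanishing_bounded u : continuous_vanishing u ->
  exists M : R, forall x, `|u x| <= M.
Proof.
move=> [cu /(_ _ ltr01)[r hr]].
have := continuous_compact (continuous_subspaceT cu) (compact_rV_ball (r := r)).
move=> /compact_bounded[M [_ hM]]; exists (Num.max 1 (M + 1)) => x.
rewrite le_max; have [xr|/hr/ltW->//] := leP (enorm x) r.
apply/orP; right; apply: (hM (M + 1)); first by rewrite ltrDl.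
by exists x => //=; rewrite (le_trans (rV_norm_le_enorm x)).
Qed.

Lemma continuous_vanishing_borel u : continuous_vanishing u -> borel_bounded u.
Proof.
move=> cu; apply/borel_boundedP; split; last exact: continuous_vanishing_bounded.
exact: measurable_continuous_rV cu.1.
Qed.

Lemma continuous_vanishing_bounded_support u (r : R) : continuous u ->
  (forall x, r < `|x| -> u x = 0) -> continuous_vanishing u.
Proof.
move=> cu ur; split => // e e0; exists (d%:R * Num.max 0 r) => x xr.
rewrite ur ?normr0//; have [d0|d0] := eqVneq d 0%N.
  exfalso; move: xr; rewrite /enorm /dot big1 ?sqrtr0 ?d0 ?mul0r ?ltxx//.
  by move=> i; have := ltn_ord i; rewrite {2}d0.
have := lt_le_trans xr (enorm_le_rV_norm x).
by rewrite ltr_pM2l ?ltr0n ?lt0n// gt_max => /andP[].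
Qed.

Lemma sup_norm_le u (e : R) : (sup_norm u <= e%:E)%E <-> forall x, `|u x| <= e.
Proof.
split=> [h x|h]; last by apply: ge_ereal_sup => _ [x _ <-]; rewrite lee_fin.
by rewrite -lee_fin (le_trans _ h)//; apply: ereal_sup_ubound; exists x.
Qed.

Lemma sup_norm_cvg0 (F : R -> 'rV[R]_d -> R) : sup_norm (F t) @[t --> 0^'+] --> 0%E ->
  forall e : R, 0 < e -> exists2 r : R, 0 < r & forall t, 0 < t < r -> forall x, `|F t x| <= e.
Proof.
move=> F0 e e0.
have : \forall t \near 0^'+, (sup_norm (F t) <= e%:E)%E.
  move: F0 => /fine_cvgP[Ffin /cvgrPdist_le/(_ _ e0) Fle].
  near=> t; have Ft : sup_norm (F t) \is a fin_num by near: t.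
  have : `|0 - fine (sup_norm (F t))| <= e by near: t.
  by rewrite -(fineK Ft) lee_fin sub0r normrN /=; apply: le_trans; exact: ler_norm.
rewrite near_withinE => /nbhs_ballP[r /= r0 hr]; exists r => // t /andP[t0 tr].
apply/sup_norm_le; apply: hr => //=; rewrite /ball/= sub0r normrN gtr0_norm//.
Unshelve. all: by end_near. Qed.

End continuous_vanishing_functions.

(** * Orbits of a Feller semigroup and its generator *)

Section semigroup_theory.
Context {R : realType} {d : nat}.
Variable P : R -> R.-spker 'rV[R]_d ~> 'rV[R]_d.
Implicit Types (u v g : 'rV[R]_d -> R) (x : 'rV[R]_d) (s t e M : R).
Local Notation T := (semigroup_op P).

Lemma kernel_le1 t x : (P t x setT <= 1)%E.
Proof. exact: sprob_kernel_le1. Qed.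

Lemma kernel_integrable t x u : borel_bounded u -> (P t x).-integrable setT (EFin \o u).
Proof.
move=> [mu bu]; apply: measurable_bounded_integrable => //.
by rewrite (le_lt_trans (kernel_le1 t x))// ltry.
Qed.

Lemma semigroup_op_le t x u M : 0 <= M -> (forall y, `|u y| <= M) -> `|T t u x| <= M.
Proof.
move=> M0 uM; apply: (@Rintegral_abs_le _ _ _ _ _ _ (fun=> M)) => //.
by rewrite integral_cst//= -[leRHS]mule1 lee_wpmul2l ?kernel_le1.
Qed.

Lemma semigroup_opB t u v : borel_bounded u -> borel_bounded v ->
  T t (fun y => u y - v y) = (fun x => T t u x - T t v x).
Proof.
move=> bu bv; apply/funext => x; rewrite /semigroup_op RintegralB//;
  exact: kernel_integrable.
Qed.

Lemma semigroup_opZ t u (k : R) : borel_bounded u ->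
  T t (fun y => k * u y) = (fun x => k * T t u x).
Proof.
move=> bu; apply/funext => x; rewrite /semigroup_op RintegralZl//.
exact: kernel_integrable.
Qed.

Lemma borel_bounded_cst M : borel_bounded (cst M : 'rV[R]_d -> R).
Proof.
apply/borel_boundedP; split; first exact: measurable_cst.
by exists `|M|.
Qed.

Lemma borel_boundedB u v : borel_bounded u -> borel_bounded v ->
  borel_bounded (fun y => u y - v y).
Proof.
move=> /borel_boundedP[mu [M uM]] /borel_boundedP[mv [N vN]].
apply/borel_boundedP; split; first exact: measurable_funB.
by exists (M + N) => x; rewrite (le_trans (ler_normB _ _))// lerD.
Qed.

Lemma borel_boundedZ u (k : R) : borel_bounded u -> borel_bounded (fun y => k * u y).
Proof.
move=> /borel_boundedP[mu [M uM]].
apply/borel_boundedP; split; first by apply: measurable_funM => //; exact: measurable_cst.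
by exists (`|k| * M) => x; rewrite normrM ler_wpM2l.
Qed.

Hypothesis PF : feller_semigroup P.

(** By contractivity everything reduces to time 0: for [s < t] the difference [T_t u - T_s u] is
    [T_s (T_(t - s) u - u)]. *)
Lemma semigroup_uniform_continuous u e : continuous_vanishing u -> 0 < e ->
  exists2 r : R, 0 < r & forall s t, 0 <= s -> 0 <= t -> `|s - t| < r ->
    forall x, `|T s u x - T t u x| <= e.
Proof.
move=> cu e0; have [r r0 hr] := sup_norm_cvg0 (feller_cont PF cu) e0.
have bu := continuous_vanishing_borel cu; exists r => // s t.
wlog st : s t / s <= t => [H s0 t0 str x|].
  have [st|/ltW ts] := leP s t; first exact: H.
  by rewrite distrC; apply: H => //; rewrite distrC.
move=> s0 t0 str x; move: st; rewrite le_eqVlt => /predU1P[->|st].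
  by rewrite subrr normr0 ltW.
have ts0 : 0 < t - s by rewrite subr_gt0.
rewrite distrC (_ : t = s + (t - s)); last by ring.
have bT : borel_bounded (T (t - s) u).
  by apply/continuous_vanishing_borel/(feller_vanishing PF) => //; exact: ltW.
rewrite (feller_add PF)//; last exact: ltW.
have := congr1 (@^~ x) (semigroup_opB s bT bu) => /= <-.
apply: semigroup_op_le; first exact: ltW.
by apply: hr; rewrite ts0/= -(gtr0_norm ts0) distrC.
Qed.

(** Kernels at negative times are arbitrary; clamping time at 0 yields a function continuous on the
    whole line, as needed at the left endpoint of [[0, t]]. *)
Lemma semigroup_time_continuous u x : continuous_vanishing u ->
  continuous (fun s => T (Num.max s 0) u x).
Proof.
move=> cu s; apply/cvgrPdist_le => e e0.
have [r r0 hr] := semigroup_uniform_continuous cu e0.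
apply/nbhs_ballP; exists r => //= s' ss'; apply: hr; rewrite ?le_max ?lexx ?orbT//.
exact: le_lt_trans (dist_max_le _ _) ss'.
Qed.

Section generator.
Variables u g : 'rV[R]_d -> R.
Hypothesis ug : generator P u g.

Let cu : continuous_vanishing u := ug.1.

(** [g] is a uniform limit of difference quotients, and functions vanishing at infinity are closed
    under uniform limits. *)
Lemma generator_continuous_vanishing : continuous_vanishing g.
Proof.
apply: continuous_vanishing_uniform_limit => e e0.
have [r r0 hr] := sup_norm_cvg0 ug.2 e0.
have r20 : 0 < r / 2 by rewrite divr_gt0.
exists (fun x => (r / 2)^-1 * (T (r / 2) u x - u x)); last first.
  by apply: hr; rewrite r20/= ltr_pdivrMr// ltr_pMr// ltr1n.
have [ct vt] := feller_vanishing PF (ltW r20) cu; have [c0 v0] := cu.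
split.
  apply: (@continuous_funM _ _ (cst _)); first exact: cst_continuous.
  exact: continuous_funB.
move=> k k0; have k' : 0 < k * (r / 2) / 2 by rewrite divr_gt0// mulr_gt0.
have [r1 h1] := vt _ k'; have [r2 h2] := v0 _ k'.
exists (Num.max r1 r2) => x; rewrite gt_max => /andP[/h1 x1 /h2 x2].
rewrite normrM gtr0_norm ?invr_gt0// mulrC ltr_pdivrMr//.
by rewrite (le_lt_trans (ler_normB _ _))// [ltRHS]splitr ltrD.
Qed.

Let cg := generator_continuous_vanishing.
Let bu := continuous_vanishing_borel cu.
Let bg := continuous_vanishing_borel cg.

(** The left-hand side is [T_s] applied to [T_h u - u - h g], so contractivity carries the estimate
    at time 0 to every [s]. *)
Lemma semigroup_increment e : 0 < e -> exists2 r : R, 0 < r &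
  forall s h, 0 <= s -> 0 < h < r -> forall x,
    `|T (s + h) u x - T s u x - h * T s g x| <= e * h.
Proof.
move=> e0; have [r r0 hr] := sup_norm_cvg0 ug.2 e0; exists r => // s h s0 /[dup] hh /andP[h0 hr'] x.
have bT : borel_bounded (T h u).
  by apply/continuous_vanishing_borel/(feller_vanishing PF) => //; exact: ltW.
have bTu := borel_boundedB bT bu; have bhg := borel_boundedZ h bg.
rewrite (feller_add PF)//; last exact: ltW.
have := congr1 (@^~ x) (semigroup_opB s bTu bhg).
rewrite (semigroup_opB s bT bu) (semigroup_opZ s h bg) => /= <-.
apply: semigroup_op_le; first by rewrite mulr_ge0// ltW.
move=> y; rewrite (_ : _ - _ = h * (h^-1 * (T h u y - u y) - g y)); last first.
  by field; rewrite gt_eqF.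
by rewrite normrM gtr0_norm// mulrC ler_wpM2r ?(ltW h0)// hr.
Qed.

Lemma is_derive_semigroup x s : 0 < s -> is_derive s 1 (fun t => T t u x) (T s g x).
Proof.
move=> s0; apply: is_derive_squeeze => e e0.
have e2 : 0 < e / 2 by rewrite divr_gt0.
have [r r0 hr] := semigroup_increment e2.
have [q q0 hq] := semigroup_uniform_continuous cg e2.
(* Keeping [|h| < s] ensures that [s + h] is still a nonnegative time. *)
exists (Num.min s (Num.min r q)); first by rewrite !lt_min s0 r0.
move=> h h0; rewrite !lt_min => /and3P[hs hr' hq']; rewrite scaler1 [h + s]addrC.
have [hp|hn] := ltP 0 h.
  rewrite (gtr0_norm hp) in hr' *.
  rewrite (le_trans (hr s h (ltW s0) _ x)) ?hp//=.
  by rewrite ler_wpM2r ?(ltW hp)//; lra.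
(* For negative [h] the forward increment is taken from [s + h]; it produces [T_(s + h) g],
   exchanged for [T_s g] at the cost of the other [e / 2]. *)
have {h0}hn : h < 0 by rewrite lt_neqAle h0.
have nh0 : 0 < - h by rewrite oppr_gt0.
rewrite (ltr0_norm hn) in hs hr' hq' *.
have sh0 : 0 <= s + h by lra.
have := hr (s + h) (- h) sh0; rewrite nh0 hr' => /(_ isT x).
rewrite addrK => h1.
have := hq s (s + h) (ltW s0) sh0; rewrite (_ : s - (s + h) = - h); last by ring.
rewrite gtr0_norm// => /(_ hq' x) h2.
rewrite (_ : _ - _ - _ = - (T s u x - T (s + h) u x - - h * T (s + h) g x) +
  (- h) * (T s g x - T (s + h) g x)); last by ring.
rewrite (le_trans (ler_normD _ _))// normrN normrM (gtr0_norm nh0).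
rewrite (le_trans (lerD h1 (ler_wpM2l (ltW nh0) h2)))//; lra.
Qed.

(** Freezing [x] makes the integral over the orbit an ordinary integral of a continuous real
    function. *)
Lemma semigroup_FTC x t : 0 < t ->
  T t u x - u x = \int[lebesgue_measure]_(s in `[0, t]) T (Num.max s 0) g x.
Proof.
move=> t0.
have dF s : 0 < s -> is_derive s 1 (fun s => T (Num.max s 0) u x) (T s g x).
  move=> s0; apply: near_eq_is_derive (is_derive_semigroup x s0).
  by near=> s'; rewrite max_l// ltW//; near: s'; exact: lt_nbhsr.
have F0 : T 0 u x = u x by rewrite (feller_0 PF).
have E : (\int[lebesgue_measure]_(s in `[0%R, t]) (T (Num.max s 0) g x)%:E =
    (T (Num.max t 0) u x)%:E - (T (Num.max 0 0) u x)%:E)%E.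
  apply: (@continuous_FTC2 R (fun s : R => T (Num.max s 0) g x)
    (fun s : R => T (Num.max s 0) u x)) => //.
  - exact: continuous_subspaceT (@semigroup_time_continuous g x cg).
  - split.
    + by move=> s; rewrite in_itv/= => /andP[s0 _]; have [] := dF _ s0.
    + by apply: cvg_at_right_filter; exact: semigroup_time_continuous.
    + by apply: cvg_at_left_filter; exact: semigroup_time_continuous.
  - move=> s; rewrite in_itv/= => /andP[s0 _].
    by rewrite derive1E max_l ?ltW//; have [] := dF _ s0.
by rewrite /Rintegral E maxxx F0 max_l// ltW.
Unshelve. all: by end_near. Qed.

End generator.

(** Dominated convergence is applied twice with the same constant [M]: against [P s x] at each time,
    then over [[0, t]]. *)
Lemma generator_increment_cvg0 (u_ g_ : nat -> 'rV[R]_d -> R) M x t : 0 < t ->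
  (forall n, generator P (u_ n) (g_ n)) ->
  (forall n y, `|g_ n y| <= M) -> (forall y, g_ ^~ y @ \oo --> (0 : R)) ->
  T t (u_ n) x - u_ n x @[n --> \oo] --> (0 : R).
Proof.
move=> t0 ug gM g0.
have M0 : 0 <= M by exact: le_trans (gM 0%N 0).
have cg n : continuous_vanishing (g_ n) := generator_continuous_vanishing (ug n).
have Tg0 s : T s (g_ n) x @[n --> \oo] --> (0 : R).
  have E0 : \int[P s x]_(z in setT) (cst (0 : R) z) = 0 by rewrite /Rintegral integral0_eq.
  rewrite -[X in _ --> X]E0.
  apply: (@Rdominated_cvg _ _ _ _ _ _ _ (cst M)) => //.
  - by move=> n; have [] := continuous_vanishing_borel (cg n).
  - exact: kernel_integrable (borel_bounded_cst M).
rewrite (_ : (fun n => _) =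
    (fun n => \int[lebesgue_measure]_(s in `[0, t]) T (Num.max s 0) (g_ n) x)); last first.
  by apply/funext => n; rewrite (semigroup_FTC (ug n) x t0).
have E0 : \int[lebesgue_measure]_(s in `[0, t]) (cst (0 : R) s) = 0.
  by rewrite /Rintegral integral0_eq.
rewrite -[X in _ --> X]E0.
apply: (@Rdominated_cvg _ _ _ lebesgue_measure _ (fun n (s : R) => T (Num.max s 0) (g_ n) x) (cst 0) (cst M)) => //.
- move=> n; apply: measurable_funTS.
  exact: continuous_measurable_fun (@semigroup_time_continuous _ x (cg n)).
- by apply: continuous_compact_integrable; [exact: segment_compact|
    apply: continuous_subspaceT => ?; exact: cst_continuous].
- by move=> n s _; exact: semigroup_op_le.
Qed.

End semigroup_theory.

Lemma feller_conservative (R : realType) (d : nat)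
    (P : R -> R.-spker 'rV[R]_d ~> 'rV[R]_d) (p : 'rV[R]_d -> 'rV[R]_d -> R[i]) (c : R) :
  feller_semigroup P -> [set u | test_function u] `<=` generator_dom P ->
  generator_symbol P p -> 0 < c ->
  (forall x xi, cabs (p x xi) <= c * (1 + enorm xi ^+ 2)) ->
  forall (t : R) x, 0 < t -> P t x setT = 1%E.
Proof.
move=> PF PD PS c0 pc t x t0.
pose l (n : nat) : R := n.+1%:R^-1; pose u n := flat_bump (l n) (0 : 'rV[R]_d).
have l0 n : 0 < l n by rewrite invr_gt0.
have l1 n : l n ^+ 2 <= 1 by rewrite expr_le1// ?invf_le1// ?ler1n// ltW.
have cu n : continuous (u n) := continuous_flat_alg (flat_bump_flat_alg _ _).
have tu n : test_function (u n).
  apply: (@flat_alg_test_function _ _ _ (l n)^-1); first exact: flat_bump_flat_alg.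
  by move=> y ly; rewrite /u flat_bump_out// subr0 ltW.
have [g ug] := choice (fun n => PD _ (tu n)).
have [K K0 hK] := @pdo_flat_bump_bound R d.
have gE n y : `|g n y| = `|complex.Re (pdo p (u n) y)|.
  have := congr1 (@complex.Re R) (symbol_generator PS (tu n) (ug n) y).
  by move=> /= ->; case: (pdo p (u n) y) => a b /=; rewrite normrN.
have sup1 y xi : cabs (p y xi) <= c + c * enorm xi ^+ 2.
  by rewrite (le_trans (pc y xi))// mulrDr mulr1.
have gM n y : `|g n y| <= K * (c + c).
  rewrite gE (le_trans (hK p y c c (l n) (l0 n) (ltW c0) (ltW c0) (sup1 y)))//.
  by rewrite ler_wpM2l ?(ltW K0)// lerD2l ler_piMr// ltW.
have g0 y : g ^~ y @ \oo --> (0 : R).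
  apply/cvgrPdist_le => e e0; have e2 : 0 < e / 2 / K by rewrite !divr_gt0.
  have [C C0 hC] := symbol_quadratic_bound c0 (symbol_levy_khinchine PS y) (pc y) e2.
  have C1 : 0 < C + 1 by rewrite ltr_wpDl.
  (* Since [l n <= 1], this threshold makes [C * l n ^+ 2] at most [e / 2 / K]; the other half of
     [e] is spent on the symbol near the origin. *)
  have le0 : 0 < e / 2 / K / (C + 1) by rewrite !divr_gt0.
  near=> n; rewrite sub0r normrN gE.
  rewrite (le_trans (hK p y _ C (l n) (l0 n) (ltW e2) C0 hC))//.
  have ln : l n <= e / 2 / K / (C + 1).
    near: n; have := @cvg_harmonic R => /cvgrPdist_le/(_ _ le0).
    apply: filterS => n; rewrite sub0r normrN; apply: le_trans; exact: ler_norm.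
  have ln2 : C * l n ^+ 2 <= e / 2 / K.
    rewrite (@le_trans _ _ ((C + 1) * l n))//; last by rewrite mulrC -ler_pdivlMr.
    rewrite ler_pM// ?sqr_ge0// ?lerDl// expr2 ler_piMr ?(ltW (l0 n))//.
    by rewrite invf_le1// ler1n.
  rewrite (le_trans (ler_wpM2l (ltW K0) (lerD (lexx _) ln2)))//.
  by rewrite -mulrDl -splitr mulrC divfK ?gt_eqF.
have H := generator_increment_cvg0 PF x t0 ug gM g0.
(* The common limit of the bumps at every point; it is positive because [flat 1] is positive at
   1. *)
pose k : R := flat_bump 0 (0 : 'rV[R]_d) 0.
have k0 : 0 < k.
  by apply: prodr_gt0 => i _; rewrite !mul0r addr0 subr0 mulr_gt0// flat1_gt0.
have uk y : u n y @[n --> \oo] --> k.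
  have ck : continuous (fun r : R => flat_bump r 0 y).
    apply: continuous_prod => i.
    have ca (b : R) : continuous (fun r : R => 1 + r * b).
      by move=> r; apply: cvgD; [exact: cvg_cst|apply: cvgM; [exact: cvg_id|exact: cvg_cst]].
    apply: continuous_funM; first exact: (continuous_compT (ca _) (@continuous_flat R 1)).
    rewrite (_ : (fun r => _) =
      (fun r : R => flat 1 (1 + r * - (y ord0 i - (0 : 'rV[R]_d) ord0 i)))).
      exact: (continuous_compT (ca _) (@continuous_flat R 1)).
    by apply/funext => r; rewrite mulrN.
  have -> : k = flat_bump 0 (0 : 'rV[R]_d) y.
    by apply: eq_bigr => i _; rewrite !mul0r.
  apply: (@cvg_comp _ _ _ l (fun r : R => flat_bump r 0 y)).
    exact: cvg_harmonic.
  exact: ck.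
have Tk : semigroup_op P t (u n) x @[n --> \oo] --> k * fine (P t x setT).
  rewrite -[X in _ --> X](@Rintegral_cst _ _ _ (P t x) setT)//.
  apply: (@Rdominated_cvg _ _ _ _ _ _ _ (cst (1 : R))) => //.
  - by move=> n; exact: measurable_continuous_rV.
  - exact: kernel_integrable (borel_bounded_cst 1).
  - by move=> n y _; rewrite ger0_norm ?flat_bump_ge0// flat_bump_le1.
(* Two limits of the same sequence [T_t u_n x - u_n x]; dividing by [k] gives total mass 1. *)
have : k * fine (P t x setT) - k = 0.
  apply: (cvg_unique _ _ H) => //; exact: cvgB.
rewrite -[X in _ - X]mulr1 -mulrBr => /eqP; rewrite mulf_eq0 gt_eqF//= subr_eq0 => /eqP E.
rewrite -(fineK (_ : P t x setT \is a fin_num)) ?E// ge0_fin_numE//.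
by rewrite (le_lt_trans (kernel_le1 P t x))// ltry.
Unshelve. all: by end_near. Qed.

Lemma nonincreasing_measure_small d (T : measurableType d) (R : realType)
    (mu : {measure set T -> \bar R}) (A : nat -> set T) (e : R) :
  (forall n, measurable (A n)) -> nonincreasing_seq A -> (mu (A 0%N) < +oo)%E ->
  \bigcap_n A n = set0 -> 0 < e -> exists n, (mu (A n) <= e%:E)%E.
Proof.
move=> mA nA A0 cA e0.
have := @nonincreasing_cvg_mu _ _ _ mu A A0 mA; rewrite cA measure0 => /(_ measurable0 nA).
move=> /fine_cvgP[Afin /cvgrPdist_le/(_ _ e0) Ae].
have [n [An1 An2]] : exists n, mu (A n) \is a fin_num /\ `|0 - fine (mu (A n))| <= e.
  have [n _ H] : \forall n \near \oo, mu (A n) \is a fin_num /\ `|0 - fine (mu (A n))| <= e.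
    by near=> n; split; near: n.
  by exists n; exact: (H n (leqnn n)).
exists n; rewrite -(fineK An1) lee_fin (le_trans _ An2)// sub0r normrN; exact: ler_norm.
Unshelve. all: by end_near. Qed.

(** * Monotone approximation of open sets by test functions *)

Section open_approximation.
Context {R : realType} {d : nat}.
Variable U : set 'rV[R]_d.
Hypothesis oU : open U.
Implicit Types y : 'rV[R]_d.

Let cell (k : 'rV[rat]_d * nat) : 'rV[R]_d := \row_j ratr (k.1 ord0 j).

(* Bumps positive exactly on the rational cubes contained in [U]. *)
Let b (n : nat) : 'rV[R]_d -> R :=
  if unpickle n is Some k then
    if `[< forall y, `|y - cell k| < k.2.+1%:R^-1 -> U y >]
    then flat_bump k.2.+1%:R (cell k) else cst 0
  else cst 0.

Let b_ge0 n y : 0 <= b n y.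
Proof.
by rewrite /b; case: unpickle => // k; case: ifPn => // _; exact: flat_bump_ge0.
Qed.

Let b_le1 n y : b n y <= 1.
Proof.
rewrite /b; case: unpickle => [k|]; last exact: ler01.
by case: ifPn => _; [exact: flat_bump_le1|exact: ler01].
Qed.

Let b_flat_alg n : flat_alg (b n).
Proof.
rewrite /b; case: unpickle => [k|]; last exact: flat_alg_cst.
by case: ifPn => _; [exact: flat_bump_flat_alg|exact: flat_alg_cst].
Qed.

Let b_gt0 n y : 0 < b n y -> U y.
Proof.
rewrite /b; case: unpickle => [k|]; last by rewrite /cst ltxx.
case: ifPn => [/asboolP kU|_]; last by rewrite /cst ltxx.
by rewrite flat_bump_gt0//; exact: kU.
Qed.

Let b_support n : exists r : R, forall y, r < `|y| -> b n y = 0.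
Proof.
rewrite /b; case: unpickle => [k|]; last by exists 0.
case: ifPn => _; last by exists 0.
exists (k.2.+1%:R^-1 + `|cell k|) => y yr; apply: flat_bump_out => //.
have := ler_normD (y - cell k) (cell k); rewrite subrK => h.
by rewrite -(lerD2r `|cell k|) (le_trans _ h)// ltW.
Qed.

Let b_cover y : U y -> exists n, 0 < b n y.
Proof.
move=> Uy; have /nbhs_ballP[e /= e0 eU] : nbhs y U by exact: open_nbhs_nbhs.
have [n n2e] : exists n : nat, n.+1%:R^-1 < e / 2.
  have e20 : 0 < e / 2 by rewrite divr_gt0.
  have /cvgrPdist_lt/(_ _ e20)[n _ hn] := @cvg_harmonic R.
  exists n; apply: le_lt_trans (hn n (leqnn n)).
  by rewrite sub0r normrN; exact: ler_norm.
have qj (j : 'I_d) : exists q : rat, `|ratr q - y ord0 j| < n.+1%:R^-1.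
  have /rat_in_itvoo[q] : y ord0 j - n.+1%:R^-1 < y ord0 j + n.+1%:R^-1.
    by rewrite ltrBlDr -addrA ltrDl addr_gt0.
  by rewrite in_itv /= => /andP[q1 q2]; exists q; rewrite ltr_distl q1 q2.
have [q qE] := choice qj.
pose k : 'rV[rat]_d * nat := (\row_j q j, n).
have yk : `|y - cell k| < n.+1%:R^-1.
  apply: rV_norm_lt => // j; rewrite !mxE distrC; exact: qE.
exists (pickle k); rewrite /b pickleK ifT; first by rewrite flat_bump_gt0.
apply/asboolP => z zk; apply: eU; rewrite -ball_normE /ball_/=.
rewrite (le_lt_trans (ler_distD (cell k) _ _))// [ltRHS]splitr ltrD//.
  exact: lt_trans yk n2e.
by rewrite distrC (lt_trans zk).
Qed.

(** The product of the [(1 - b k) ^+ m] for [k < m]. Raising to a growing power sends it to 0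
    wherever some [b k] is positive, and it decreases in [m]; a finite product also stays inside
    [flat_alg] and equals 1 far away. *)
Let p m y : R := \prod_(k < m) \prod_(i < m) (1 - b k y).

Let p_ge0 m y : 0 <= p m y.
Proof. by do 2![apply: prodr_ge0 => ? _]; rewrite subr_ge0. Qed.

Let pE m y : p m y = \prod_(k < m) (1 - b k y) ^+ m.
Proof. by apply: eq_bigr => k _; rewrite prodr_const card_ord. Qed.

Let p_le m y : p m.+1 y <= p m y.
Proof.
rewrite !pE big_ord_recr/= -[leRHS]mulr1.
have b1 k : 0 <= 1 - b k y <= 1 by rewrite subr_ge0 b_le1/= lerBlDr lerDl.
apply: ler_pM.
- by apply: prodr_ge0 => k _; rewrite exprn_ge0// subr_ge0.
- by rewrite exprn_ge0// subr_ge0.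
- apply: ler_prod => k _; rewrite exprn_ge0 ?subr_ge0//= exprS ler_piMl//.
    by rewrite exprn_ge0 ?subr_ge0.
  by have /andP[] := b1 k.
- by rewrite exprn_ile1//; have /andP[] := b1 m.
Qed.

Let p_le1 m y : p m y <= 1.
Proof. by elim: m => [|m IH]; [rewrite /p big_ord0|exact: le_trans (p_le m y) IH]. Qed.

Let p_cvg0 y : U y -> p m y @[m --> \oo] --> (0 : R).
Proof.
move=> /b_cover[j bj].
have a01 : `|1 - b j y| < 1 by rewrite ger0_norm ?subr_ge0//; lra.
apply: (@squeeze_cvgr _ _ _ _ (cst 0) (fun m => (1 - b j y) ^+ m)).
- near=> m; rewrite p_ge0/= pE.
  have jm : (j < m)%N by near: m; exact: nbhs_infty_gt.
  rewrite (bigD1 (Ordinal jm))//= ler_piMr//.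
    by rewrite exprn_ge0 ?subr_ge0.
  apply: prodr_ile1 => k _; rewrite exprn_ge0 ?subr_ge0//=.
  by rewrite exprn_ile1 ?subr_ge0// lerBlDr lerDl.
- exact: cvg_cst.
- exact: cvg_expr.
Unshelve. all: by end_near. Qed.

Let p_support m : exists r : R, forall y, r < `|y| -> p m y = 1.
Proof.
have [r hr] := choice b_support; exists (\big[Num.max/0]_(k < m) r k) => y yr.
rewrite pE big1// => k _; rewrite hr ?subr0 ?expr1n//.
by apply: le_lt_trans yr; exact: (le_bigmax _ (fun k : 'I_m => r k)).
Qed.

Lemma open_approximation : exists u : nat -> 'rV[R]_d -> R,
  [/\ forall m, test_function (u m) /\ continuous_vanishing (u m),
      forall m y, 0 <= u m y <= 1, forall m y, ~ U y -> u m y = 0,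
      forall y, nondecreasing_seq (u ^~ y) &
      forall y, U y -> u m y @[m --> \oo] --> (1 : R)].
Proof.
(* This is [1 - p m y], written with the sum and product constructors of [flat_alg]. *)
exists (fun m y => 1 + -1 * p m y); split.
- move=> m; have fp : flat_alg (fun y => 1 + -1 * p m y).
    apply: flat_algD; [exact: flat_alg_cst|apply: flat_algM; first exact: flat_alg_cst].
    apply: flat_alg_prod => i; apply: flat_alg_prod => _; rewrite (_ : (fun x => _) = (fun x => 1 + -1 * b i x)).
      by apply: flat_algD; [exact: flat_alg_cst|apply: flat_algM => //; exact: flat_alg_cst].
    by apply/funext => x; rewrite mulN1r.
  have [r hr] := p_support m.
  have h0 y : r < `|y| -> 1 + -1 * p m y = 0 by move=> /hr ->; rewrite mulr1 subrr.
  split; first exact: flat_alg_test_function h0.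
  exact: continuous_vanishing_bounded_support (continuous_flat_alg fp) h0.
- by move=> m y; have := p_ge0 m y; have := p_le1 m y; move=> ? ?; apply/andP; split; lra.
- move=> m y nU; suff -> : p m y = 1 by rewrite mulr1 subrr.
  rewrite pE big1// => k _; suff -> : b k y = 0 by rewrite subr0 expr1n.
  apply/eqP; rewrite eq_le b_ge0 andbT leNgt; apply/negP => /b_gt0; exact: nU.
- by move=> y; apply/nondecreasing_seqP => m; have := p_le m y; lra.
- move=> y /p_cvg0 p0; rewrite -[X in _ --> X]addr0 -[X in _ --> _ + X](mulr0 (-1)).
  by apply: cvgD; [exact: cvg_cst|apply: cvgM; [exact: cvg_cst|exact: p0]].
Qed.

End open_approximation.

(** * Outer regularity of finite Borel measures *)

Section outer_regularity.
Context {R : realType} {d : nat}.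
Variable mu : {measure set 'rV[R]_d -> \bar R}.
Hypothesis mu_lty : (mu setT < +oo)%E.

(** Outer approximation of a set and of its complement at once, with small overlap. The symmetry
    gives stability under complements, which outer approximation alone would not. *)
Let two_sided (B : set 'rV[R]_d) := forall e : R, 0 < e -> exists V W,
  [/\ open V, open W, B `<=` V, ~` B `<=` W & (mu (V `&` W) <= e%:E)%E].

Let mu_lty' A : measurable A -> (mu A < +oo)%E.
Proof. by move=> mA; apply: le_lt_trans mu_lty; apply: le_measure; rewrite ?inE. Qed.

(** The approximating functions vanish off [B] and increase to 1 on it, so the open sets where they
    are below one half cover the complement and meet [B] in sets decreasing to nothing. *)
Let two_sided_open B : open B -> two_sided B.
Proof.
move=> oB e e0; have [u [tu u01 u0 nu u1]] := open_approximation oB.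
pose W m := [set y | u m y < 2^-1].
have oW m : open (W m).
  apply: (@open_comp _ _ (u m) [set r | r < 2^-1]); last exact: open_lt.
  by move=> y _; exact: (tu m).2.1.
have [n hn] : exists n, (mu (B `&` W n) <= e%:E)%E.
  apply: nonincreasing_measure_small => //.
  - by move=> n; apply: measurableI; apply: open_measurable_rV.
  - apply/nonincreasing_seqP => n; apply/subsetPset => y [By]; rewrite /W/= => h; split => //.
    by apply: le_lt_trans h; exact: nu.
  - by apply: mu_lty'; apply: measurableI; apply: open_measurable_rV.
  - apply/seteqP; split => // y h; have By := (h 0%N I).1.
    have half : (0 : R) < 2^-1 by [].
    have [n _ hn] : \forall n \near \oo, `|1 - u n y| < 2^-1.
      by have /cvgrPdist_lt := u1 y By; exact.
    have := hn n (leqnn n); have := (h n I).2; rewrite /W/= ltr_norml => h1 /andP[_ h2].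
    lra.
exists B, (W n); split => // y nB.
by rewrite /W/= u0.
Qed.

(** An infinite intersection of the [W n] need not be open, so only the first [N] are intersected;
    finiteness of [mu] makes the part [A N] of the union not covered by [V 0, ..., V (N - 1)]
    small. *)
Let two_sided_bigcup (F : (set 'rV[R]_d)^nat) : (forall n, measurable (F n)) ->
  (forall n, two_sided (F n)) -> two_sided (\bigcup_k F k).
Proof.
(* These errors sum to less than [e / 2]; the other half is for [A N]. *)
move=> mF hF e e0; have en n : 0 < e / 2 ^+ n.+2 by rewrite divr_gt0// exprn_gt0.
have [V /choice[W VW]] := choice (fun n => hF n _ (en n)).
have oV n : open (V n) by have [] := VW n.
have oW n : open (W n) by have [] := VW n.
have mV n : measurable (V n) by exact: open_measurable_rV.
pose A N := (\bigcup_n V n) `\` (\bigcup_(n in [set n | (n < N)%N]) V n).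
have mA N : measurable (A N).
  by apply: measurableD; apply: bigcup_measurable => // n _; exact: mV.
have [N hN] : exists N, (mu (A N) <= (e / 2)%:E)%E.
  apply: nonincreasing_measure_small => //.
  - apply/nonincreasing_seqP => n; apply/subsetPset => y [Vy nVy]; split => //.
    by apply: contra_not nVy => -[k /= kn Vk]; exists k => //=; rewrite ltnS ltnW.
  - exact: mu_lty'.
  - apply/seteqP; split => // y h; have [[k _ Vk] _] := h 0%N I.
    by have [_] := h k.+1 I; apply; exists k => /=.
  - by rewrite divr_gt0.
exists (\bigcup_n V n), (\bigcap_(n in `I_N) W n); split.
- exact: bigcup_open.
- rewrite bigcap_mkord; elim/big_ind : _ => [|? ?|n _]; [exact: openT|exact: openI|exact: oW].
- by move=> y [k _ Fk]; exists k => //; have [_ _ + _ _] := VW k; apply.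
- move=> y nF k _; have [_ _ _ + _] := VW k; apply => Fk; apply: nF; by exists k.
- have sub : \bigcup_n V n `&` \bigcap_(n in `I_N) W n `<=`
      \big[setU/set0]_(n < N) (V n `&` W n) `|` A N.
    move=> y [[n _ Vn] hW]; rewrite -(bigcup_mkord N (fun n => V n `&` W n)).
    have [[k kN Vk]|nV] := pselect ((\bigcup_(n in [set n | (n < N)%N]) V n) y).
      by left; exists k => //; split => //; exact: hW.
    by right; split => //; exists n.
  have mVW n : measurable (V n `&` W n) by apply: measurableI; exact: open_measurable_rV.
  have mB : measurable (\big[setU/set0]_(n < N) (V n `&` W n)).
    by apply: bigsetU_measurable => n _.
  have sum_le : (\sum_(n < N) mu (V n `&` W n) <= (e / 2)%:E)%E.
    apply: (@le_trans _ _ (\sum_(n < N) (e / 2 ^+ n.+2)%:E)%E).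
      by apply: lee_sum => n _; have [] := VW n.
    rewrite sumEFin lee_fin; have -> : \sum_(n < N) e / 2 ^+ n.+2 = e / 2 - e / 2 ^+ N.+1.
      elim: N {hN sub mB} => [|N IH]; first by rewrite big_ord0 expr1 subrr.
      by rewrite big_ord_recr/= IH !exprS; field; rewrite expf_neq0.
    by rewrite lerBlDr lerDl divr_ge0 ?exprn_ge0// ltW.
  apply: (@le_trans _ _ (mu (\big[setU/set0]_(n < N) (V n `&` W n) `|` A N))).
    apply: le_measure; rewrite ?inE//.
    - apply: measurableI; first by apply: bigcup_measurable.
      by apply: bigcap_measurableType => n _; exact: open_measurable_rV.
    - exact: measurableU.
  rewrite (splitr e) EFinD (le_trans (measureU2 _ mB (mA N)))// leeD//.
  apply: le_trans sum_le.
  exact: (@Boole_inequality _ _ _ mu (fun n => V n `&` W n) N).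
Qed.

Lemma outer_regularity (B : set 'rV[R]_d) (e : R) : measurable B -> 0 < e ->
  exists2 V : set 'rV[R]_d, open V & B `<=` V /\ (mu (V `\` B) <= e%:E)%E.
Proof.
move=> mB e0; suff H : two_sided B.
  have [V [W [oV oW BV BW VW]]] := H _ e0; exists V => //; split => //.
  apply: le_trans VW; apply: le_measure; rewrite ?inE.
  - by apply: measurableD => //; exact: open_measurable_rV.
  - by apply: measurableI; apply: open_measurable_rV.
  - by move=> y [Vy nBy]; split => //; exact: BW.
apply: (@dynkin_induction _ 'rV[R]_d (@open 'rV[R]_d)) mB => //.
- by move=> A1 A2; exact: openI.
- exact: two_sided_open openT.
- move=> S _ hS e' /hS[V [W [? ? ? ? VW]]].
  by exists W, V; split => //; rewrite ?setCK// setIC.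
- by move=> F mF _; exact: two_sided_bigcup.
Qed.

End outer_regularity.

(** * The strong Feller property *)

Lemma continuous_near_dist (R : realType) (T : topologicalType) (f : T -> R) x (e : R) :
  continuous f -> 0 < e -> \forall z \near x, `|f x - f z| <= e.
Proof. by move=> cf e0; have /cvgrPdist_le := cf x; exact. Qed.

Lemma continuous_max0 (R : realType) : continuous (fun r : R => Num.max r 0).
Proof.
move=> r; apply/cvgrPdist_le => e e0; apply/nbhs_ballP; exists e => //= s rs.
by rewrite (le_trans (dist_max_le _ _))// ltW.
Qed.

(** * From equi-absolute continuity to the strong Feller property *)

Section strong_feller_criterion.
Context {R : realType} {d : nat}.
Variable P : R -> R.-spker 'rV[R]_d ~> 'rV[R]_d.
Hypothesis PF : feller_semigroup P.
Variable t : R.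
Hypothesis t0 : 0 < t.
Hypothesis cons : forall x, P t x setT = 1%E.
Local Notation T := (semigroup_op P t).
Implicit Types (x y z : 'rV[R]_d) (A B : set 'rV[R]_d) (e : R).

(** The common consequence of both conditions, at a fixed time: [r'] is uniform over starting points
    in a ball, and the test sets are confined to a box. *)
Definition locally_equi_absolutely_continuous := forall (r : R) (n : nat) e, 0 < e ->
  exists2 r' : R, 0 < r' & forall B, measurable B -> B `<=` rV_box n%:R ->
    (lebesgue_rV d B <= r'%:E)%E -> forall z, `|z| <= r -> (P t z B <= e%:E)%E.

Hypothesis ac : locally_equi_absolutely_continuous.

Let Pfin z B : measurable B -> P t z B \is a fin_num.
Proof.
move=> mB; rewrite ge0_fin_numE// (@le_lt_trans _ _ (P t z setT))//.
  by apply: le_measure; rewrite ?inE.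
by rewrite (le_lt_trans (kernel_le1 P t z))// ltry.
Qed.

Let semigroup_op_indic B : measurable B -> T (\1_B) = (fun z => fine (P t z B)).
Proof.
move=> mB; apply/funext => z; rewrite /semigroup_op /Rintegral integral_indic//.
by rewrite setIT.
Qed.

Let kernel_setC z B : measurable B -> fine (P t z (~` B)) = 1 - fine (P t z B).
Proof.
move=> mB; have mBC := measurableC mB; have := cons z.
rewrite -(setUv B) measureU ?setICr// => /(congr1 fine).
by rewrite fineD ?Pfin//= => <-; rewrite addrAC subrr add0r.
Qed.

Let borel_bounded_indic B : measurable B -> borel_bounded (\1_B : 'rV[R]_d -> R).
Proof.
move=> mB; apply/borel_boundedP; split; first exact: measurable_indic.
by exists 1 => y; rewrite indicE; case: (_ \in _); rewrite ?normr1 ?normr0.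
Qed.

(** Equal to 1 for [|y| <= n - 1], to 0 for [|y| >= n], and affine in [|y|] between. *)
Let cutoff (n : nat) y : R := Num.max (1 - Num.max (1 + `|y| - n%:R) 0) 0.

Let cutoff01 n y : 0 <= cutoff n y <= 1.
Proof.
by rewrite /cutoff le_max lexx orbT/= ge_max ler01 andbT lerBlDr lerDl le_max lexx orbT.
Qed.

Let cutoff_out n y : n%:R <= `|y| -> cutoff n y = 0.
Proof.
move=> ny; rewrite /cutoff max_r// subr_le0 le_max; apply/orP; left; lra.
Qed.

Let cutoff_vanishing n : continuous_vanishing (cutoff n).
Proof.
apply: (@continuous_vanishing_bounded_support _ _ _ n%:R); last first.
  by move=> y /ltW; exact: cutoff_out.
have cn : continuous (fun y : 'rV[R]_d => `|y|) by exact: norm_continuous.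
have c1 : continuous (fun r : R => 1 + r - n%:R).
  by move=> r; apply: cvgB; [apply: cvgD; [exact: cvg_cst|exact: cvg_id]|exact: cvg_cst].
have c2 : continuous (fun r : R => 1 - r).
  by move=> r; apply: cvgB; [exact: cvg_cst|exact: cvg_id].
have cm := @continuous_max0 R.
exact: (continuous_compT (continuous_compT (continuous_compT (continuous_compT cn c1) cm) c2) cm).
Qed.

Let cutoff_cvg y : cutoff n y @[n --> \oo] --> (1 : R).
Proof.
apply: cvg_near_cst; have [m hm] : exists m : nat, 1 + `|y| <= m%:R.
  by exists (Num.bound (1 + `|y|)); rewrite ltW// archi_boundP// addr_ge0.
near=> n; have nm : (m <= n)%N by near: n; exact: nbhs_infty_ge.
have mn : m%:R <= n%:R :> R by rewrite ler_nat.
rewrite /cutoff [X in 1 - X]max_r; first by rewrite subr0 max_l.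
by rewrite subr_le0 (le_trans hm).
Unshelve. all: by end_near. Qed.

(** A cutoff lies below the indicator of the box, and its image under [T] is continuous and nearly 1
    at [x], so one box serves a whole neighbourhood. *)
Let tight x e : 0 < e -> exists n : nat, \forall z \near x, (P t z (~` rV_box n%:R) <= e%:E)%E.
Proof.
move=> e0; have e2 : 0 < e / 2 by rewrite divr_gt0.
have Tc : T (cutoff n) x @[n --> \oo] --> (1 : R).
  have -> : (1 : R) = \int[P t x]_(y in setT) (cst 1 y).
    by rewrite Rintegral_cst//= cons mul1r.
  apply: (@Rdominated_cvg _ _ _ _ _ _ _ (cst 1)) => //.
  - by move=> n; have [] := continuous_vanishing_borel (cutoff_vanishing n).
  - exact: kernel_integrable (borel_bounded_cst 1).
  - by move=> n y _; have /andP[? ?] := cutoff01 n y; rewrite ger0_norm.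
have [n hn] : exists n, `|1 - T (cutoff n) x| <= e / 2.
  by move/cvgrPdist_le/(_ _ e2) : Tc => [n _ hn]; exists n; exact: (hn n (leqnn n)).
exists n; have cT := (feller_vanishing PF (ltW t0) (cutoff_vanishing n)).1.
have mb := @measurable_rV_box R d n%:R.
apply: filterS (continuous_near_dist x cT e2) => z hz.
rewrite -(fineK (Pfin z (measurableC mb))) lee_fin kernel_setC//.
have : T (cutoff n) z <= fine (P t z (rV_box n%:R)).
  have := congr1 (@^~ z) (semigroup_op_indic mb) => /= <-.
  apply: le_Rintegral => //.
  - exact: kernel_integrable (continuous_vanishing_borel (cutoff_vanishing n)).
  - exact: kernel_integrable (borel_bounded_indic mb).
  - move=> y _; rewrite indicE; case: (boolP (y \in _)) => [_|/negP]; last first.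
      rewrite inE => yn; rewrite cutoff_out// leNgt; apply/negP => ny; apply: yn => i.
      have := le_lt_trans (rV_norm_coord y i) ny.
      by rewrite ltr_norml => /andP[-> /ltW ->].
    by have /andP[] := cutoff01 n y.
move: hn hz; rewrite !ler_norml => /andP[_ h1] /andP[_ h2] h3; lra.
Qed.

(** Inside the box given by tightness Lebesgue measure is finite, so the sets shrink there in
    Lebesgue measure and equi-absolute continuity applies on a ball around [x]; tightness bounds the
    rest. *)
Lemma small_tail (A : nat -> set 'rV[R]_d) x e : (forall n, measurable (A n)) ->
  nonincreasing_seq A -> \bigcap_n A n = set0 -> 0 < e ->
  exists N, \forall z \near x, (P t z (A N) <= e%:E)%E.
Proof.
move=> mA nA A0 e0; have e2 : 0 < e / 2 by rewrite divr_gt0.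
have [n hn] := tight x e2.
have mb := @measurable_rV_box R d n%:R.
have [r r0 hr] := ac (`|x| + 1) n e2.
have [N hN] : exists N, (lebesgue_rV d (A N `&` rV_box n%:R) <= r%:E)%E.
  apply: nonincreasing_measure_small => //.
  - by move=> k; exact: measurableI.
  - by move=> j k jk; apply/subsetPset; apply: setSI; apply/subsetPset; exact: nA.
  - apply: (@le_lt_trans _ _ (lebesgue_rV d (rV_box n%:R))).
      by apply: le_measure; rewrite ?inE//; exact: measurableI.
    exact: lebesgue_rV_box_lty.
  - apply/seteqP; split => // y h; suff : (\bigcap_k A k) y by rewrite A0.
    by move=> k _; exact: (h k I).1.
exists N; have xr : \forall z \near x, `|z| <= `|x| + 1.
  apply/nbhs_ballP; exists 1 => //= z; rewrite -ball_normE /= => xz.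
  rewrite -[z](subrK x) addrC (le_trans (ler_normD _ _))// lerD2l.
  by rewrite distrC ltW.
near=> z.
have -> : A N = (A N `&` rV_box n%:R) `|` (A N `&` ~` rV_box n%:R).
  by rewrite -setIUr setUv setIT.
have mAC : measurable (A N `&` ~` rV_box n%:R).
  by apply: measurableI => //; exact: measurableC.
rewrite (le_trans (measureU2 _ (measurableI _ _ (mA N) mb) mAC))//.
rewrite (splitr e) EFinD leeD//.
  apply: hr => //; first exact: measurableI.
  by near: z.
apply: (@le_trans _ _ (P t z (~` rV_box n%:R))); last by near: z.
by apply: le_measure; rewrite ?inE//; exact: measurableC.
Unshelve. all: by end_near. Qed.

(** [T (u N)] is continuous, and [u N] differs from the indicator of [U] by at most [e / 2] except
    on [A N], where the difference is at most 1 and whose mass is small uniformly near [x]. *)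
Let continuous_open U : open U -> continuous (fun z => fine (P t z U)).
Proof.
move=> oU; have mU := open_measurable_rV oU.
have [u [tu u01 u0 nu u1]] := open_approximation oU.
apply: continuous_local_uniform_limit => x e e0.
have e2 : 0 < e / 2 by rewrite divr_gt0.
pose A m := U `&` [set y | u m y < 1 - e / 2].
have mu m : measurable_fun setT (u m) by have [] := continuous_vanishing_borel (tu m).2.
have mA m : measurable (A m).
  apply: measurableI => //; apply: open_measurable_rV.
  apply: (@open_comp _ _ (u m) [set r | r < 1 - e / 2]); last exact: open_lt.
  by move=> y _; exact: (tu m).2.1.
have [N hN] : exists N, \forall z \near x, (P t z (A N) <= (e / 2)%:E)%E.
  apply: small_tail => //.
  - apply/nonincreasing_seqP => n; apply/subsetPset => y [By]; rewrite /=; split => //.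
    by apply: le_lt_trans b; exact: nu.
  - apply/seteqP; split => // y h; have By := (h 0%N I).1.
    have [n _ hn] : \forall n \near \oo, `|1 - u n y| < e / 2.
      by have /cvgrPdist_lt := u1 y By; exact.
    have := hn n (leqnn n); have := (h n I).2; rewrite /= ltr_norml => h1 /andP[_ h2].
    lra.
exists (T (u N)); first exact: (feller_vanishing PF (ltW t0) (tu N).2).1.
apply: filterS hN => z hz; have -> : fine (P t z U) = T (\1_U) z by rewrite semigroup_op_indic.
have b1 := borel_bounded_indic mU; have bA := borel_bounded_indic (mA N).
have := congr1 (@^~ z) (semigroup_opB P t (continuous_vanishing_borel (tu N).2) b1) => /= <-.
apply: (@Rintegral_abs_le _ _ _ _ _ _ (fun y => e / 2 + \1_(A N) y)) => [y _|].
  rewrite !indicE; have /andP[un0 un1] := u01 N y.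
  have [yU|yU] := boolP (y \in U); last first.
    have nU : ~ U y by move=> /mem_set; exact/negP.
    by rewrite (u0 N y nU) subr0 normr0 addr_ge0 ?ler0n// ltW.
  have [yA|yA] := boolP (y \in A N).
    by rewrite /= ler_norml; apply/andP; split; rewrite /=; lra.
  have : 1 - e / 2 <= u N y.
    by rewrite leNgt; apply/negP => h; move: yA; rewrite notin_setE; apply; split => //; rewrite -inE.
  by rewrite /= => ?; rewrite ler_norml; apply/andP; split; lra.
under eq_integral do rewrite EFinD.
rewrite ge0_integralD//=; first last.
- by apply/measurable_EFinP; exact: measurable_indic.
- by rewrite lee_fin ltW.
rewrite integral_cst//= cons mule1 integral_indic// setIT [X in (_ <= X%:E)%E]splitr EFinD.
exact: leeD.
Qed.

Let continuous_measurable B : measurable B -> continuous (fun z => fine (P t z B)).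
Proof.
move=> mB; apply: (@dynkin_induction _ 'rV[R]_d (@open 'rV[R]_d)
  (fun B => continuous (fun z => fine (P t z B)))) mB => //.
- by move=> A1 A2; exact: openI.
- exact: continuous_open openT.
(* Conservativeness enters here: the total mass is constant in [z]. *)
- move=> S mS cS; rewrite (_ : (fun z => _) = (fun z => 1 - fine (P t z S))).
    by apply: continuous_funB => //; exact: cst_continuous.
  by apply/funext => z; rewrite kernel_setC.
(* Finite partial unions give finite sums of continuous functions; the remainders [A N] decrease to
   the empty set. *)
- move=> F mF tF cF; apply: continuous_local_uniform_limit => x e e0.
  pose A N := \bigcup_n F n `\` \bigcup_(n < N) F n.
  have mU : measurable (\bigcup_n F n) by exact: bigcup_measurable.
  have mUN N : measurable (\bigcup_(n < N) F n) by apply: bigcup_measurable => // k _.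
  have mA N : measurable (A N) by exact: measurableD.
  have [N hN] : exists N, \forall z \near x, (P t z (A N) <= e%:E)%E.
    apply: small_tail => //.
    - apply/nonincreasing_seqP => n; apply/subsetPset => y [Vy nVy]; split => //.
      by apply: contra_not nVy => -[k /= kn Vk]; exists k => //=; rewrite ltnS ltnW.
    - apply/seteqP; split => // y h; have [[k _ Vk] _] := h 0%N I.
      by have [_] := h k.+1 I; apply; exists k => /=.
  have UN z : fine (P t z (\bigcup_(n < N) F n)) = \sum_(n < N) fine (P t z (F n)).
    rewrite bigcup_mkord measure_bigsetU//=.
      rewrite (eq_bigr (fun n : 'I_N => (fine (P t z (F n)))%:E)) ?sumEFin//.
      by move=> n _; rewrite fineK// Pfin.
  exists (fun z => fine (P t z (\bigcup_(n < N) F n))).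
    rewrite (_ : (fun z => _) = (fun z => \sum_(n < N) fine (P t z (F n)))).
      elim: N {hN UN} => [|N IH].
        rewrite (_ : (fun z => _) = (fun=> 0)); first exact: cst_continuous.
        by apply/funext => z; rewrite big_ord0.
      rewrite (_ : (fun z => _) = (fun z => \sum_(n < N) fine (P t z (F n)) +
          fine (P t z (F N)))); first exact: continuous_funD.
      by apply/funext => z; rewrite big_ord_recr.
    by apply/funext => z; rewrite UN.
  apply: filterS hN => z hz.
  have E : fine (P t z (\bigcup_n F n)) =
      fine (P t z (\bigcup_(n < N) F n)) + fine (P t z (A N)).
    rewrite -fineD; try exact: Pfin.
    have UA : (\bigcup_(n < N) F n) `&` A N = set0.
      by apply/seteqP; split => // y [Uy [_]].
    rewrite -measureU//.
    congr (fine (P t z _)); apply/seteqP; split => y; last first.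
      by move=> [[k _ Fk]|[]//]; exists k.
    by move=> Uy; have [|nUy] := pselect ((\bigcup_(n < N) F n) y); [left|right].
  rewrite E opprD addrA subrr sub0r normrN ger0_norm ?fine_ge0//.
  by rewrite -lee_fin fineK// Pfin.
Qed.

Let good (u : 'rV[R]_d -> R) := borel_bounded u /\ continuous (T u).

Let good_indic B : measurable B -> good (\1_B).
Proof.
move=> mB; split; last by rewrite semigroup_op_indic//; exact: continuous_measurable.
exact: borel_bounded_indic.
Qed.

Let goodB u v : good u -> good v -> good (fun y => u y - v y).
Proof.
move=> [bu cu] [bv cv]; split; first exact: borel_boundedB.
by rewrite semigroup_opB//; exact: continuous_funB.
Qed.

Let goodZ k u : good u -> good (fun y => k * u y).
Proof.
move=> [bu cu]; split; first exact: borel_boundedZ.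
rewrite semigroup_opZ//; apply: (@continuous_funM _ _ (cst k)) => //.
exact: cst_continuous.
Qed.

Let goodD u v : good u -> good v -> good (fun y => u y + v y).
Proof.
move=> gu /(goodZ (-1)) gv; rewrite (_ : (fun y => _) = (fun y => u y - -1 * v y)).
  exact: goodB.
by apply/funext => y; rewrite mulN1r opprK.
Qed.

(** The sum counts the integers from 1 to [n] that do not exceed [w], that is, it equals the integer
    part of [w]. *)
Let staircase (w : R) (n : nat) : 0 <= w <= n%:R ->
  0 <= w - \sum_(k < n) ((k.+1%:R <= w)%R : nat)%:R <= 1.
Proof.
elim: n => [|n IH] /andP[w0 wn].
  by rewrite big_ord0 subr0 w0 (le_trans wn).
have [wn'|nw] := leP w n%:R.
  rewrite big_ord_recr/= (_ : (n.+1%:R <= w) = false) ?addr0 ?IH ?w0//.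
  by apply/negbTE; rewrite -ltNge (le_lt_trans wn')// ltr_nat.
rewrite big_ord_recr/= (eq_bigr (fun=> 1)); last first.
  by move=> k _; rewrite (_ : (_ <= _) = true)//= (le_trans _ (ltW nw))// ler_nat.
rewrite sumr_const card_ord; move: wn; rewrite -natr1 => wn.
by case: (leP (n%:R + 1) w) => /= h; apply/andP; split; rewrite ?mulr1n ?mulr0n; lra.
Qed.

Lemma strong_feller_of_ac u : borel_bounded u -> continuous_bounded (T u).
Proof.
move=> bu; have /borel_boundedP[mu [M' uM']] := bu.
pose M : R := `|M'| + 1; have M0 : 0 < M by rewrite ltr_wpDl.
have uM y : `|u y| <= M.
  by rewrite (le_trans (uM' y))// (le_trans (ler_norm M'))// lerDl.
split; last first.
  exists M; split; first exact: num_real.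
  by move=> N MN x _; apply: (le_trans (semigroup_op_le P t x (ltW M0) uM)); exact: ltW.
apply: continuous_uniform_limit => e e0.
have [n hn] : exists n : nat, 2 * M / n.+1%:R <= e.
  have eM : 0 < e / (2 * M) by rewrite divr_gt0// mulr_gt0.
  have /cvgrPdist_le/(_ _ eM)[n _ hn] := @cvg_harmonic R.
  exists n; rewrite mulrC -ler_pdivlMr ?mulr_gt0//.
  apply: le_trans (hn n (leqnn n)); rewrite sub0r normrN; exact: ler_norm.
(* Mesh of the range: [w] rescales [u] from [[- M, M]] to [[0, n + 1]], and rounding [w] down costs
   at most [c] in [u]. *)
pose c := 2 * M / n.+1%:R; have c0 : 0 < c by rewrite divr_gt0// mulr_gt0.
pose w y := (u y + M) / c.
(* The constant [M] is written as a multiple of an indicator, so that [h] is a linear combination of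
   indicators throughout. *)
pose h y := (\sum_(k < n.+1) c * \1_[set y | k.+1%:R <= w y] y) - M * \1_setT y.
have gh : good h.
  apply: goodB; last exact/goodZ/good_indic.
  have mw (k : nat) : measurable [set y | k%:R <= w y].
    rewrite (_ : [set y | _] = u @^-1` `[k%:R * c - M, +oo[).
      by rewrite -[X in measurable X]setTI; apply: bu.1.
    by apply/seteqP; split => y /=; rewrite in_itv/= andbT /w ler_pdivlMr// lerBlDr.
  elim: n.+1 {h} => [|m IH].
    rewrite (_ : (fun y => _) = (fun y => 0 * \1_setT y)).
      exact/goodZ/good_indic.
    by apply/funext => y; rewrite big_ord0 mul0r.
  rewrite (_ : (fun y => _) = (fun y => \sum_(k < m) c * \1_[set y | k.+1%:R <= w y] y +
      c * \1_[set y | m.+1%:R <= w y] y)).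
    by apply: goodD => //; apply: goodZ; exact: good_indic.
  by apply/funext => y; rewrite big_ord_recr.
exists (T h); first exact: gh.2.
move=> x; have := congr1 (@^~ x) (semigroup_opB P t gh.1 bu) => /= <-.
apply: semigroup_op_le; first exact: ltW.
move=> y; apply: le_trans hn.
have /andP[uM1 uM2] : - M <= u y <= M by rewrite -ler_norml.
have w0 : 0 <= w y <= n.+1%:R.
  rewrite divr_ge0 ?(ltW c0)//=; last lra.
  rewrite ler_pdivrMr// /c mulrC divfK ?pnatr_eq0//; lra.
have := staircase w0; rewrite /h -mulr_sumr.
under [in X in X -> _]eq_bigr => k _.
  rewrite (_ : (_ <= _)%R = (y \in [set y | k.+1%:R <= w y])); last first.
    by apply/idP/idP; rewrite inE.
  rewrite -indicE; over.
set s := \sum_(k < n.+1) _ => /andP[s0 s1].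
have -> : c * s - M * \1_setT y - u y = - (c * (w y - s)).
  rewrite indicE in_setT /w mulr1; field; rewrite gt_eqF//.
rewrite normrN ger0_norm ?mulr_ge0 ?(ltW c0)//.
by rewrite -[leRHS]mulr1 ler_wpM2l// ltW.
exact: ltW.
Qed.

End strong_feller_criterion.

(** * Orlicz norms of functions with values in the unit interval *)

Section orlicz.
Context {R : realType}.
Variable Phi : R -> R.
Hypothesis yPhi : young_function Phi.
Hypothesis Phi_ge0 : forall x, 0 <= Phi x.
Local Open Scope ereal_scope.

Lemma young_conjugate_ge (x y : R) : (0 <= x)%R ->
  (x * `|y| - Phi x)%:E <= young_conjugate Phi y.
Proof. by move=> x0; apply: ereal_sup_ubound; exists x. Qed.

Lemma young_conjugate_ge0 (y : R) : 0 <= young_conjugate Phi y.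
Proof. by have := @young_conjugate_ge 0 y (lexx _); rewrite mul0r (young_0 yPhi) subr0. Qed.

(** An uncountable supremum, but of continuous functions of [y], hence lower semicontinuous. *)
Lemma measurable_young_conjugate : measurable_fun setT (young_conjugate Phi).
Proof.
apply: lower_semicontinuous_measurable; apply/lower_semicontinuousP => a.
rewrite (_ : [set x | _] = \bigcup_(x in [set x : R | (0 <= x)%R])
    [set y : R | (a < x * `|y| - Phi x)%R]).
  apply: bigcup_open => x _.
  apply: (@open_comp _ _ (fun y : R => x * `|y| - Phi x)%R [set r | (a < r)%R]); last exact: open_gt.
  move=> y _; apply: cvgB; last exact: cvg_cst.
  by apply: cvgM; [exact: cvg_cst|exact: norm_continuous].
apply/seteqP; split => y /=.
  by move=> /ereal_sup_gt[_ [x x0 <-]]; rewrite lte_fin => h; exists x.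
by move=> [x x0 h]; rewrite (lt_le_trans _ (young_conjugate_ge y x0))// lte_fin.
Qed.

Lemma young_convex0 (v x : R) : (0 <= v <= 1)%R -> (Phi (v * x) <= v * Phi x)%R.
Proof.
move=> /andP[v0 v1].
have := young_convex yPhi (Itv01 v0 v1) (in_setT x) (in_setT 0%R).
by rewrite {1}/conv/= scaler0 addr0 convRE/= (young_0 yPhi) mulr0 addr0.
Qed.

(* Young's inequality [v |g| / l <= Phi (v / l) + Phi_c g], with
   [Phi (v / l) <= v * Phi l^-1] by convexity since [0 <= v <= 1]. *)
Lemma orlicz_norm_le d (T : measurableType d) (mu : {measure set T -> \bar R})
    (v : T -> R) (l : R) : measurable_fun setT v -> (forall y, 0 <= v y <= 1)%R -> (0 < l)%R ->
  orlicz_norm mu Phi v <= l%:E + (l * Phi l^-1)%:E * \int[mu]_y (v y)%:E.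
Proof.
move=> mv v01 l0; have v0 y : (0 <= v y)%R by have /andP[] := v01 y.
have c0 : (0 <= l * Phi l^-1)%R by rewrite mulr_ge0// ltW.
apply: ge_ereal_sup => _ [g [mg hg] <-].
have myg : measurable_fun setT (fun y => young_conjugate Phi (g y)).
  exact: measurableT_comp measurable_young_conjugate mg.
apply: (@le_trans _ _ (\int[mu]_y (l%:E * young_conjugate Phi (g y) +
    (l * Phi l^-1)%:E * (v y)%:E))).
  apply: nonneg_integral_mono => y _; first by rewrite lee_fin.
  have vl0 : (0 <= v y / l)%R by rewrite divr_ge0// ltW.
  have := young_conjugate_ge (g y) vl0; have := young_convex0 l^-1 (v01 y).
  have := young_conjugate_ge0 (g y).
  case: (young_conjugate Phi (g y)) => [r| |]//=.
    rewrite !lee_fin => r0 h1 h2; rewrite normrM ger0_norm//.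
    have := ler_wpM2l (ltW l0) h2; have := ler_wpM2l (ltW l0) h1.
    rewrite mulrBr (_ : l * (v y / l * _) = v y * `|g y|)%R; first lra.
    by field; rewrite gt_eqF.
  by move=> _ _ _; rewrite gt0_muley ?lte_fin// addye ?leey.
rewrite ge0_integralD//=; last 4 first.
- by move=> y _; rewrite mule_ge0 ?lee_fin ?(ltW l0)// young_conjugate_ge0.
- exact: measurable_funeM.
- by move=> y _; rewrite -EFinM lee_fin mulr_ge0.
- by apply: measurable_funeM; exact/measurable_EFinP.
rewrite leeD//.
  rewrite ge0_integralZl//=; last 2 first.
  - by move=> y _; exact: young_conjugate_ge0.
  - by rewrite lee_fin ltW.
  by rewrite -[leRHS]mule1 lee_wpmul2l// lee_fin ltW.
rewrite ge0_integralZl//=.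
- exact/measurable_EFinP.
- by move=> y _; rewrite lee_fin.
Qed.

End orlicz.

(** * Equi-absolute continuity from each of the two conditions *)

Section absolute_continuity.
Context {R : realType} {d : nat}.
Variable P : R -> R.-spker 'rV[R]_d ~> 'rV[R]_d.

Lemma loc_unif_abs_continuous_equi (t : R) :
  loc_unif_abs_continuous P t -> locally_equi_absolutely_continuous P t.
Proof.
(* A ball of negative radius is empty, whereas condition (1) speaks of nonempty compact sets. *)
move=> H r n e e0; have [r0|r0] := ltP r 0.
  exists 1 => // B _ _ _ z zr; exfalso.
  by have := lt_le_trans r0 (normr_ge0 z); rewrite ltNge zr.
have K0 : [set x : 'rV[R]_d | `|x| <= r] !=set0 by exists 0; rewrite /= normr0.
have := H _ (compact_rV_ball (r := r)) K0.
set F : R -> \bar R := fun eps => _ => FE.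
have : \forall q \near 0^'+, (F q <= e%:E)%E.
  move: FE => /fine_cvgP[Ffin /cvgrPdist_le/(_ _ e0) Fle].
  near=> q; have Fq : F q \is a fin_num by near: q.
  have : `|0 - fine (F q)| <= e by near: q.
  by rewrite -(fineK Fq) lee_fin sub0r normrN /=; apply: le_trans; exact: ler_norm.
rewrite near_withinE => /nbhs_ballP[q /= q0 hq].
have q2 : 0 < q / 2 by rewrite divr_gt0.
exists (q / 2) => // B mB _ Bq z zr.
have : (F (q / 2)%R <= e%:E)%E.
  apply: hq => //=; rewrite /ball/= sub0r normrN gtr0_norm//.
  by rewrite ltr_pdivrMr// ltr_pMr// ltr1n.
apply: le_trans; apply: (@le_trans _ _ (ereal_sup [set P t z B | z in [set x | `|x| <= r]])).
  by apply: ereal_sup_ubound; exists z.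
by apply: ereal_sup_ubound; exists B.
Unshelve. all: by end_near. Qed.

Lemma orlicz_bounded_equi (t : R) :
  orlicz_bounded P t -> locally_equi_absolutely_continuous P t.
Proof.
move=> [Phi [yP P0 _ hK]] r n e e0.
have [C hC] := hK _ (compact_rV_ball (r := r)).
(* [C'] is a positive majorant of [C]. The choice of [l] gives [C' * l = e / 2], and [b] is then the
   coefficient of the integral of [u]. *)
pose C' : R := `|C| + 1; have C'0 : 0 < C' by rewrite ltr_wpDl.
pose l := e / 2 / C'; have l0 : 0 < l by rewrite !divr_gt0.
pose b := C' * (l * Phi l^-1); have b0 : 0 <= b by apply: mulr_ge0; [exact: ltW|apply: mulr_ge0; [exact: ltW|exact: P0]].
have test u z : test_function u -> continuous_vanishing u -> (forall y, 0 <= u y <= 1) ->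
    `|z| <= r ->
    ((semigroup_op P t u z)%:E <= (e / 2)%:E + b%:E * \int[lebesgue_rV d]_y (u y)%:E)%E.
  move=> tu cu u01 zr.
  have mu : measurable_fun setT u := measurable_continuous_rV cu.1.
  apply: (@le_trans _ _ `|semigroup_op P t u z|%:E); first by rewrite lee_fin ler_norm.
  have h1 : (`|semigroup_op P t u z|%:E <= C%:E * orlicz_norm (lebesgue_rV d) Phi u)%E.
    by apply: le_trans (hC u tu); apply: ereal_sup_ubound; exists z.
  have N0 : (0 <= orlicz_norm (lebesgue_rV d) Phi u)%E.
    apply: ereal_sup_ubound; exists (cst 0); last first.
      by rewrite integral0_eq// => y _; rewrite mulr0 normr0.
    split; first exact: measurable_cst.
    rewrite /= integral0_eq ?lee01// => x _ /=.
    apply/eqP; rewrite eq_le young_conjugate_ge0// andbT.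
    by apply: ge_ereal_sup => _ [s _ <-]; rewrite normr0 mulr0 sub0r lee_fin oppr_le0.
  apply: (le_trans h1); apply: (@le_trans _ _ (C'%:E * orlicz_norm (lebesgue_rV d) Phi u)%E).
    by rewrite lee_wpmul2r// lee_fin /C' (le_trans (ler_norm C))// lerDl.
  rewrite (le_trans (lee_wpmul2l _ (orlicz_norm_le yP P0 _ mu u01 l0)))//; first by rewrite lee_fin ltW.
  rewrite ge0_muleDr ?lee_fin ?(ltW l0)//; last first.
    apply: mule_ge0; first by rewrite lee_fin; apply: mulr_ge0; [exact: ltW|exact: P0].
    by apply: integral_ge0 => y _; rewrite lee_fin; have /andP[] := u01 y.
  rewrite muleA -!EFinM -/b (_ : C' * l = e / 2)//.
  by rewrite /l mulrC divfK ?gt_eqF.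
have openP U (L : R) z : open U -> (lebesgue_rV d U <= L%:E)%E -> `|z| <= r ->
    (P t z U <= (e / 2 + b * L)%:E)%E.
  move=> oU UL zr; have mU := open_measurable_rV oU.
  have [u [tu u01 u0 nu u1]] := open_approximation oU.
  have Tu m : semigroup_op P t (u m) z <= e / 2 + b * L.
    rewrite -lee_fin (le_trans (test _ _ (tu m).1 (tu m).2 (u01 m) zr))//.
    rewrite (EFinD (e / 2) (b * L)) (EFinM b L); apply: leeD2l.
    apply: lee_wpmul2l; first by rewrite lee_fin.
    apply: le_trans UL.
    apply: (@le_trans _ _ (\int[lebesgue_rV d]_y (\1_U y)%:E)%E).
      apply: nonneg_integral_mono => y _; first by rewrite lee_fin; have /andP[] := u01 m y.
      rewrite lee_fin indicE; case: (boolP (y \in U)) => [_|]; first by have /andP[] := u01 m y.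
      by move/negP; rewrite inE => /u0 ->.
    by rewrite integral_indic// setIT.
  have Pfin : P t z U \is a fin_num.
    rewrite ge0_fin_numE// (@le_lt_trans _ _ (P t z setT))//.
      by apply: le_measure; rewrite ?inE.
    by rewrite (le_lt_trans (kernel_le1 P t z))// ltry.
  have Tcvg : semigroup_op P t (u m) z @[m --> \oo] --> fine (P t z U).
    have -> : fine (P t z U) = \int[P t z]_(y in setT) (\1_U y).
      by rewrite /Rintegral integral_indic// setIT.
    apply: (@Rdominated_cvg _ _ _ _ _ _ _ (cst 1)) => //.
    - by move=> m; exact: measurable_continuous_rV (tu m).2.1.
    - move=> y _; rewrite indicE; case: (boolP (y \in U)) => [|/negP].
        by rewrite inE; exact: u1.
      rewrite inE => yU; apply: cvg_near_cst; near=> m; exact: u0.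
    - exact: kernel_integrable (borel_bounded_cst 1).
    - by move=> m y _; have /andP[? ?] := u01 m y; rewrite ger0_norm.
  rewrite -(fineK Pfin) lee_fin; apply: (cvgr_to_le Tcvg).
  by apply: nearW => m; exact: Tu.
have b1 : 0 < b + 1 by rewrite ltr_wpDl.
(* The open set below has measure at most [2 * q], and [e / 2 + b * (2 * q) <= e]. *)
pose q := e / 4 / (b + 1); have q0 : 0 < q by rewrite !divr_gt0.
exists q => // B mB Bn Bq z zr.
(* Outer regularity needs a finite measure, so Lebesgue measure is restricted to a bounded open set.
   The radius exceeds [n] because the box reaches points of norm [n]. *)
pose Q := [set y : 'rV[R]_d | `|y| < n%:R + 1].
have oQ : open Q.
  apply: (@open_comp _ _ (fun y : 'rV[R]_d => `|y|) [set s | s < n%:R + 1]); last exact: open_lt.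
  by move=> y _; exact: norm_continuous.
have mQ := open_measurable_rV oQ.
have BQ : B `<=` Q.
  move=> y /Bn yn; rewrite /Q/= (@le_lt_trans _ _ n%:R)//; last by rewrite ltrDl.
  by apply: rV_norm_le => // i; rewrite ler_norml; have /andP[/ltW -> ->] := yn i.
have Qfin : (mrestr (lebesgue_rV d) mQ setT < +oo)%E.
  rewrite /mrestr setTI (@le_lt_trans _ _ (lebesgue_rV d (rV_box (n%:R + 1))))//.
    apply: le_measure; rewrite ?inE//; first exact: measurable_rV_box.
    move=> y Qy i; have := le_lt_trans (rV_norm_coord y i) Qy.
    by rewrite ltr_norml => /andP[-> /ltW ->].
  by apply: lebesgue_rV_box_lty; rewrite addr_ge0.
have [V oV [BV VB]] := outer_regularity Qfin mB q0.
have mV := open_measurable_rV oV.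
have UL : (lebesgue_rV d (V `&` Q) <= (q + q)%:E)%E.
  rewrite (_ : V `&` Q = B `|` ((V `\` B) `&` Q)).
    rewrite EFinD (le_trans (measureU2 _ mB _))//; last exact: leeD.
    by apply: measurableI => //; exact: measurableD.
  apply/seteqP; split => y.
    by move=> [Vy Qy]; have [By|nBy] := pselect (B y); [left|right].
  by move=> [By|[[Vy _] Qy]]; split => //; [exact: BV|exact: BQ].
apply: (@le_trans _ _ (P t z (V `&` Q))).
  apply: le_measure; rewrite ?inE//; first exact: measurableI.
  by move=> y By; split; [exact: BV|exact: BQ].
rewrite (le_trans (openP _ _ _ (openI oV oQ) UL zr))// lee_fin.
have : (b + 1) * q = e / 4 by rewrite /q mulrC divfK ?gt_eqF.
by rewrite mulrDl mul1r => h; lra.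
Unshelve. all: by end_near. Qed.

End absolute_continuity.

Theorem theorem3p1 (R : realType) (d : nat)
    (P : R -> R.-spker 'rV[R]_d ~> 'rV[R]_d)
    (p : 'rV[R]_d -> 'rV[R]_d -> R[i]) :
  (0 < d)%N ->
  feller_semigroup P ->
  [set u | test_function u] `<=` generator_dom P ->
  generator_symbol P p ->
  (exists2 c : R, 0 < c & forall xi : 'rV[R]_d,
    (ereal_sup [set (cabs (p x xi))%:E | x in setT] <=
     (c * (1 + enorm xi ^+ 2))%:E)%E) ->
  continuous (fun x => p x 0 : R[i]^o) ->
  (forall t : R, 0 < t -> loc_unif_abs_continuous P t) \/
  (forall t : R, 0 < t -> orlicz_bounded P t) ->
  strong_feller P.
Proof.
move=> _ PF PD PS [c c0 hc] _ H t u t0 bu.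
have pc x xi : cabs (p x xi) <= c * (1 + enorm xi ^+ 2).
  by rewrite -lee_fin (le_trans _ (hc xi))//; apply: ereal_sup_ubound; exists x.
apply: strong_feller_of_ac => //.
  by move=> x; exact: feller_conservative PF PD PS c0 pc t x t0.
by case: H => /(_ t t0); [exact: loc_unif_abs_continuous_equi|exact: orlicz_bounded_equi].
Qed.
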